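(* Let $n,d\ge1$ and let $\{L(t)\}_{t\ge0}$ be a measurable, locally essentially bounded family of $n\times n$ matrices such that $L(t)$ is weight-balanced for all $t\ge0$, and such that the resulting flow $\Phi(t,s)$, defined by $\dot{\Phi}(t,s)=-L(t)\Phi(t,s)$, $\Phi(s,s)=I$, $t\ge s\ge0$, is weakly exponentially ergodic. Then the dynamics $$\dot{\mathbf{x}}(t)=-L(t)\mathbf{x}(t)+\mathbf{u}(t),\qquad \mathbf{y}(t)=\mathbf{x}(t),$$ with $\mathbf{x}(t),\mathbf{u}(t),\mathbf{y}(t)\in\mathbb{R}^{n\times d}$, is a distributed flow tracker with respect to $Q=\mathbb{R}^{n\times d}$. Hence, for any convex and differentiable functions $f_1,\dots,f_n:\mathbb{R}^d\to\mathbb{R}$ with bounded gradients such that $X^*=\operatorname{argmin}_{x\in\mathbb{R}^d}\sum_{i=1}^n f_i(x)$ is nonempty, and for any non-increasing $\alpha:[0,\infty)\to(0,1]$ with $\int_0^\infty\alpha(t)\,dt=\infty$ and $\int_0^\infty\alpha^2(t)\,dt<\infty$, with the feedback $u_i(t)=-\alpha(t)\nabla f_i(y_i(t))$, $i\in[n]$, and any initial condition $\mathbf{x}(0)\in\mathbb{R}^{n\times d}$, there is some $x^*\in X^*$ such that $\lim_{t\to\infty}x_i(t)=x^*$ for all $i\in[n]$.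
   Context: Notation: $[n]=\{1,\dots,n\}$. Vectors in $\mathbb{R}^d=\mathbb{R}^{1\times d}$ (including gradients) are row vectors; $\mathbf{x}\in\mathbb{R}^{n\times d}$ has rows $x_1,\dots,x_n$ (similarly for $\mathbf{u},\mathbf{y}$), and $\bar{x}=\frac1n\sum_{i=1}^n x_i$. $\|\cdot\|$ is the $\ell_2$-norm on vectors and the induced operator norm on matrices. A generalized Laplacian matrix is a square matrix with non-positive off-diagonal entries whose columns add to zero. $L$ is weight-balanced if both $L$ and $L^T$ are generalized Laplacian matrices. Solutions of the ODEs are in the Carathéodory sense. $\mathbb{S}$ is the set of $n\times n$ column-stochastic matrices and $\mathbb{S}_1\subset\mathbb{S}$ the subset of rank-one ones (matrices with identical stochastic columns); $d(x,A)=\inf_{y\in A}\|x-y\|$. The flow $\{\Phi(t,s)\}$ is weakly exponentially ergodic if there are $\lambda\in(0,1)$ and $a>0$ with $d(\Phi(t,s),\mathbb{S}_1)\le a\lambda^{t-s}$ for all $t\ge s\ge0$. Distributed flow tracker (general definition): consider a dynamics $\dot{x}_i=p_i(t,\mathbf{x},\mathbf{w},u_i)$, $\dot{w}_i=q_i(t,\mathbf{x},\mathbf{w})$, $y_i=h_i(t,x_i,w_i,u_i)$, $i\in[n]$, with $x_i,y_i,u_i\in\mathbb{R}^d$, $w_i\in\mathbb{R}^{n_i}$, $n_i\ge0$, $N=\sum_i n_i$, $\mathbf{w}\in\mathbb{R}^N$. For a sequence of directed graphs $\mathcal{G}(t)=([n],\mathcal{E}(t))$, it is a distributed flow tracker with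 respect to $Q\subseteq\mathbb{R}^{n\times d}\times\mathbb{R}^N$ if: (I) $\frac{\partial p_i}{\partial x_j}=\frac{\partial p_i}{\partial w_j}=\frac{\partial q_i}{\partial x_j}=\frac{\partial q_i}{\partial w_j}=0$ for all $(i,j)\notin\mathcal{E}(t)$ and all $t\ge0$; (II) for some constant $c_1>0$, $\dot{\bar{x}}(t)=c_1\sum_{i=1}^n u_i(t)$; (III) for all $i\in[n]$, $\|y_i(t)-\bar{x}(t)\|\le c_2\left(\lambda^t\|\mathbf{x}(0)\|+\int_0^t\lambda^{t-s}\|\mathbf{u}(s)\|\,ds\right)$ holds for all initial conditions $(\mathbf{x}(0),\mathbf{w}(0))\in Q$ and all smooth control inputs $\mathbf{u}:\mathbb{R}^+\to\mathbb{R}^{n\times d}$, for some $\lambda\in[0,1)$ and $c_2>0$ (possibly dependent on $\mathbf{u}$). In this theorem $N=0$ (there is no $\mathbf{w}$), and the graph sequence is the one associated with $L(t)$: $(i,j)\in\mathcal{E}(t)$ iff $i=j$ or $L_{ij}(t)\neq0$. *)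

(* Defs.v *)
From HB Require Import structures.
From mathcomp Require Import all_boot all_order all_algebra.
From mathcomp Require Import all_classical all_reals all_analysis.
From mathcomp Require Import measurable_realfun.

Set Implicit Arguments.
Unset Strict Implicit.
Unset Printing Implicit Defensive.

Import Order.TTheory GRing.Theory Num.Theory.
Import numFieldNormedType.Exports.

Local Open Scope classical_set_scope.
Local Open Scope ring_scope.

(** The norm [`|_|] that the library puts on matrices is the entrywise maximum;
    the Euclidean norm and its induced operator norm are therefore defined
    here. *)
Definition l2norm (R : realType) (k : nat) (v : 'rV[R]_k) : R :=
  Num.sqrt (\sum_(j < k) v 0 j ^+ 2).

Definition opnorm (R : realType) (m k : nat) (A : 'M[R]_(m, k)) : R :=
  sup [set l2norm (A *m v^T)^T | v in [set v : 'rV[R]_k | l2norm v <= 1]].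

Definition opdist (R : realType) (m k : nat) (X : 'M[R]_(m, k))
    (A : set 'M[R]_(m, k)) : R :=
  inf [set opnorm (X - Y) | Y in A].

Definition column_stochastic (R : realType) (n : nat) : set 'M[R]_n :=
  [set A | (forall i j, 0 <= A i j) /\ (forall j, \sum_(i < n) A i j = 1)].

Definition rank_one_stochastic (R : realType) (n : nat) : set 'M[R]_n :=
  [set A | @column_stochastic R n A /\ \rank A = 1%N].

Definition generalized_laplacian (R : realType) (n : nat) (A : 'M[R]_n) : Prop :=
  (forall i j, i != j -> A i j <= 0) /\ (forall j, \sum_(i < n) A i j = 0).

Definition weight_balanced (R : realType) (n : nat) (A : 'M[R]_n) : Prop :=
  generalized_laplacian A /\ generalized_laplacian A^T.

(** Measurability is Lebesgue measurability, i.e. with respect to the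
    completion of the Borel sigma-algebra by the negligible sets. *)
Definition measurable_family (R : realType) (n : nat) (L : R -> 'M[R]_n) : Prop :=
  forall i j (B : set R), measurable B ->
    (completed_algebra_gen (@lebesgue_measure R)).-sigma.-measurable
      (`[0%R, +oo[ `&` (fun t => L t i j) @^-1` B).

Definition locally_ess_bounded (R : realType) (n : nat) (L : R -> 'M[R]_n) : Prop :=
  forall T : R, exists M : R,
    {ae @lebesgue_measure R, forall t, 0 <= t <= T -> opnorm (L t) <= M}.

(** Absolute continuity on [[a, b]]; [I] is a finite list of subintervals
    [(c, e)] of [[a, b]], pairwise non-overlapping. All norms on a space of
    matrices are equivalent, so the choice of norm on [V] is irrelevant there. *)
Definition abs_continuous (R : realType) (V : normedModType R) (a b : R)
    (f : R -> V) : Prop :=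
  forall eps : R, 0 < eps -> exists2 delta : R, 0 < delta &
    forall I : seq (R * R),
      all (fun ce => (a <= ce.1) && (ce.1 <= ce.2) && (ce.2 <= b)) I ->
      pairwise (fun ce ce' => (ce.2 <= ce'.1) || (ce'.2 <= ce.1)) I ->
      \sum_(ce <- I) (ce.2 - ce.1) < delta ->
      \sum_(ce <- I) `|f ce.2 - f ce.1| < eps.

(** [x' = v] on [[t0, +oo[] in the sense of Caratheodory. For an equation
    [x' = F(t, x)], take [v t := F t (x t)]. *)
Definition caratheodory (R : realType) (V : normedModType R) (t0 : R)
    (x v : R -> V) : Prop :=
  (forall T : R, abs_continuous t0 T x) /\
  {ae @lebesgue_measure R, forall t, t0 <= t -> is_derive t 1 x (v t)}.

Definition is_flow (R : realType) (n : nat) (L : R -> 'M[R]_n)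
    (Phi : R -> R -> 'M[R]_n) : Prop :=
  forall s, 0 <= s ->
    Phi s s = 1%:M /\
    caratheodory s (fun t => Phi t s) (fun t => - (L t *m Phi t s)).

Definition weakly_exp_ergodic (R : realType) (n : nat)
    (Phi : R -> R -> 'M[R]_n) : Prop :=
  exists lambda a : R, [/\ 0 < lambda < 1, 0 < a &
    forall s t, 0 <= s -> s <= t ->
      opdist (Phi t s) (@rank_one_stochastic R n) <= a * lambda `^ (t - s)].

(** Smoothness on the closed half-line [[0, +oo[]: restriction to it of a
    C^infinity function on the line. *)
Definition smooth_nneg (R : realType) (V : normedModType R) (u : R -> V) : Prop :=
  exists2 v : R -> V, (forall k t, derivable (derive1n k v) t 1) &
    forall t, 0 <= t -> u t = v t.

Definition row_mean (R : realType) (n d : nat) (x : 'M[R]_(n, d)) : 'rV[R]_d :=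
  n%:R^-1 *: \sum_(i < n) row i x.

(** The dynamics [x_i' = p_i(t, x, w, u_i)], [w_i' = q_i(t, x, w)],
    [y_i = h_i(t, x_i, w_i, u_i)]. The vector [w] is the concatenation of the
    blocks [w_i = submxrow w i] of length [wdim i]. *)
Record dynamics (R : realType) (n d : nat) := Dynamics {
  wdim : 'I_n -> nat;
  dyn_p : 'I_n -> R -> 'M[R]_(n, d) -> 'rV[R]_(\sum_i wdim i) ->
          'rV[R]_d -> 'rV[R]_d;
  dyn_q : forall i : 'I_n, R -> 'M[R]_(n, d) -> 'rV[R]_(\sum_i wdim i) ->
          'rV[R]_(wdim i);
  dyn_h : forall i : 'I_n, R -> 'rV[R]_d -> 'rV[R]_(wdim i) ->
          'rV[R]_d -> 'rV[R]_d
}.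

Arguments dyn_p {R n d} D i : rename.
Arguments dyn_q {R n d} D i : rename.
Arguments dyn_h {R n d} D i : rename.

Definition dyn_solution (R : realType) (n d : nat) (D : dynamics R n d)
    (u x : R -> 'M[R]_(n, d)) (w : R -> 'rV[R]_(\sum_i wdim D i)) : Prop :=
  caratheodory 0 x
    (fun t => \matrix_(i < n) dyn_p D i t (x t) (w t) (row i (u t))) /\
  caratheodory 0 w (fun t => \mxrow_(i < n) dyn_q D i t (x t) (w t)).

Definition dyn_output (R : realType) (n d : nat) (D : dynamics R n d)
    (u x : R -> 'M[R]_(n, d)) (w : R -> 'rV[R]_(\sum_i wdim D i))
    (i : 'I_n) (t : R) : 'rV[R]_d :=
  dyn_h D i t (row i (x t)) (submxrow (w t) i) (row i (u t)).

(** [p_i] and [q_i] have zero partial derivatives with respect to [x_j] and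
    [w_j] when [(i, j)] is not an edge. The derivatives are taken along every coordinate of [x_j]
    and of [w_j]; [tagnat.Rank j b] is the position in [w] of the coordinate
    [b] of [w_j]. *)
Definition respects_graph (R : realType) (n d : nat) (D : dynamics R n d)
    (E : R -> rel 'I_n) : Prop :=
  forall (t : R) (i j : 'I_n), 0 <= t -> ~~ E t i j ->
  forall (x : 'M[R]_(n, d)) (w : 'rV[R]_(\sum_i wdim D i)),
    (forall v : 'rV[R]_d,
      (forall a : 'I_d, is_derive (0 : R) 1
        (fun s : R => dyn_p D i t (x + s *: delta_mx j a) w v) 0) /\
      (forall b : 'I_(wdim D j), is_derive (0 : R) 1
        (fun s : R => dyn_p D i t x (w + s *: delta_mx 0 (tagnat.Rank j b)) v) 0))
    /\ (forall a : 'I_d, is_derive (0 : R) 1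
        (fun s : R => dyn_q D i t (x + s *: delta_mx j a) w) 0)
    /\ (forall b : 'I_(wdim D j), is_derive (0 : R) 1
        (fun s : R => dyn_q D i t x (w + s *: delta_mx 0 (tagnat.Rank j b))) 0).

Definition mean_tracks_input (R : realType) (n d : nat) (D : dynamics R n d) : Prop :=
  exists2 c1 : R, 0 < c1 &
    forall (u x : R -> 'M[R]_(n, d)) (w : R -> 'rV[R]_(\sum_i wdim D i)),
      dyn_solution u x w ->
      caratheodory 0 (fun t => row_mean (x t))
        (fun t => c1 *: \sum_(i < n) row i (u t)).

(** The constants may depend on the input but not on the
    initial condition. *)
Definition output_tracks_mean (R : realType) (n d : nat) (D : dynamics R n d)
    (Q : set ('M[R]_(n, d) * 'rV[R]_(\sum_i wdim D i))) : Prop :=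
  forall u : R -> 'M[R]_(n, d), smooth_nneg u ->
  exists lambda c2 : R, [/\ 0 <= lambda < 1, 0 < c2 &
    forall (x : R -> 'M[R]_(n, d)) (w : R -> 'rV[R]_(\sum_i wdim D i)),
      dyn_solution u x w -> Q (x 0, w 0) ->
      forall (i : 'I_n) (t : R), 0 <= t ->
        l2norm (dyn_output u x w i t - row_mean (x t)) <=
        c2 * (lambda `^ t * opnorm (x 0) +
              \int[@lebesgue_measure R]_(s in `[0%R, t])
                 (lambda `^ (t - s) * opnorm (u s)))].

Definition distributed_flow_tracker (R : realType) (n d : nat)
    (D : dynamics R n d) (E : R -> rel 'I_n)
    (Q : set ('M[R]_(n, d) * 'rV[R]_(\sum_i wdim D i))) : Prop :=
  [/\ respects_graph D E, mean_tracks_input D & output_tracks_mean Q].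

(** [x' = - L(t) x + u], [y = x], with no auxiliary state [w]. *)
Definition laplacian_dynamics (R : realType) (n d : nat) (L : R -> 'M[R]_n) :
    dynamics R n d :=
  @Dynamics R n d (fun _ => 0%N)
    (fun i t x _ v => - row i (L t *m x) + v)
    (fun _ _ _ _ => 0)
    (fun _ _ xi _ _ => xi).

Definition laplacian_graph (R : realType) (n : nat) (L : R -> 'M[R]_n) :
    R -> rel 'I_n :=
  fun t i j => (i == j) || (L t i j != 0).

Definition grad (R : realType) (d : nat) (f : 'rV[R]_d -> R) (z : 'rV[R]_d) :
    'rV[R]_d :=
  \row_(j < d) derive f z (delta_mx 0 j).

Definition argmin (R : realType) (T : Type) (F : T -> R) : set T :=
  [set z | forall y, F z <= F y].

(* Main.v *)
Require Import Defs.
From HB Require Import structures.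
From mathcomp Require Import all_boot all_order all_algebra.
From mathcomp Require Import all_classical all_reals all_analysis.
From mathcomp Require Import measurable_realfun ring lra.

Set Implicit Arguments.
Unset Strict Implicit.
Unset Printing Implicit Defensive.

Import Order.TTheory GRing.Theory Num.Theory.
Import numFieldNormedType.Exports.

Local Open Scope classical_set_scope.
Local Open Scope ring_scope.

(** Write J = (1/n) 1 1^T and P = I - J. Weight balance gives J L = L J = 0, so
    averaging the dynamics leaves the mean driven by the averaged input alone,
    and the disagreement e = P x obeys the same equation with input P u:
    e' = - L e + P u.

    Weight balance also gives y . L y >= 0 for every y, so the equation is
    dissipative: along w' = - L w + g the Frobenius norm of w grows at most at
    rate |g| ([dissipative_estimate]). Everything about the flow is extracted
    from that: with g = 0 it yields uniqueness of solutions, hence the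
    semigroup law, and conservation of centredness. Weak ergodicity puts
    Phi(t, s) within C lam^(t - s) of some pi 1^T, which kills centred matrices;
    so Phi(t, s) contracts these at that rate ([flow_contraction]).

    The variation of constants formula is replaced by a discrete version. On a
    partition with steps of length at most 1, e(t') and Phi(t', t) e(t) differ
    by a centred defect bounded, by dissipativity, by the integral of the
    input over [t, t']; transporting the defects to the final time and summing
    gives [tracking_sum]. Over one step lam^(T - s) varies by a factor at most
    1/lam, so the sum is comparable with the discounted integral that tracking
    asks for ([output_tracking]).

    For the optimisation part, put a_k = alpha(k). On unit intervals the input
    is O(a_k), so the disagreement is bounded by a sequence D_k obeying a
    geometric recursion forced by a_k; as the sum of a_k^2 is finite, so are
    those of D_k^2 and of q_k = 2 M a_k D_k. Convexity gives, for the distance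
    of the mean to a minimizer z, a decrease at rate (alpha/n) (F(mean) - F(z))
    up to the error q_k. Hence the mean stays bounded and, the integral of
    alpha being infinite, F(mean) comes arbitrarily close to its minimum at
    arbitrarily late times ([value_liminf]). A cluster point p of the means at
    such times is a minimizer; the distance to p is small at some late time and
    can afterwards grow only by a tail of the series of q_k. So the mean
    converges to p, and the disagreement tends to 0.

    Derivatives exist only almost everywhere, and all differential inequalities
    are integrated by [abs_continuous_comparison]. *)

(** * Monotonicity from almost everywhere derivatives *)

(** A derivative at [t] controls increments over intervals with [t] inside,
    not only at an endpoint; this is the form that tagged partitions use. *)
Lemma derive_le0_straddle (R : realType) (g : R -> R) (t D eps : R) :
  is_derive t 1 g D -> D <= 0 -> 0 < eps ->
  exists2 r : R, 0 < r & forall x y, t - r < x -> x <= t -> t <= y -> y < t + r ->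
    g y - g x <= eps * (y - x).
Proof.
move=> [gd gD] D0 e0.
have : h^-1 *: (g (h *: 1 + t) - g t) @[h --> 0^'] --> D by rewrite -gD; exact: gd.
move=> /cvgrPdist_le /(_ _ e0) [/= r r0 rP].
have H h : `|h| < r -> `|g (h + t) - g t - h * D| <= eps * `|h|.
  move=> hr; have [->|h0] := eqVneq h 0.
    by rewrite add0r subrr mul0r subrr !normr0 mulr0.
  have := rP h; rewrite /ball_/= sub0r normrN => /(_ hr h0).
  rewrite distrC [h *: 1]mulr1 /GRing.scale/=.
  rewrite -(ler_pM2r (_ : 0 < `|h|)) ?normr_gt0// -normrM.
  by rewrite mulrBl mulrAC mulVf// mul1r [D * h]mulrC.
exists r => // x y rx xt ty yr.
have := H (y - t); rewrite ger0_norm ?subr_ge0// subrK => /(_ _)/ler_normlW.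
have := H (x - t); rewrite ler0_norm ?subr_le0// subrK distrC.
move=> /(_ _)/ler_normlW h1 h2.
have {}h1 := h1 ltac:(lra). have {}h2 := h2 ltac:(lra).
have : D * (y - x) <= 0 by apply: mulr_le0_ge0 => //; lra.
nra.
Qed.

(** The exceptional null set is covered by an open set [W] of small measure.
    Each point has a neighbourhood whose intervals around it either satisfy the
    inequality up to [eps * length], or lie inside [W]. A chain of such
    intervals leads from [a] to [b]: the first kind contributes little by
    construction, and the second kind has small total length, so there absolute
    continuity bounds the increments of [N], and the one-sided Lipschitz bound
    those of [U]. That bound is one-sided so that it holds with [M = 0] for
    every nondecreasing [U]. *)
Lemma abs_continuous_comparison (R : realType) (N U : R -> R) (a b M : R) :
  a <= b -> abs_continuous a b N -> 0 <= M ->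
  (forall s t, a <= s -> s <= t -> t <= b -> U s - U t <= M * (t - s)) ->
  {ae @lebesgue_measure R, forall t, a <= t <= b ->
     exists2 D : R, D <= 0 & is_derive t 1 (fun t => N t - U t) D} ->
  N b - N a <= U b - U a.
Proof.
move=> ab acN M0 UM [A [mA A0 HA]].
apply/ler_addgt0Pr => eps0 eps0_gt0.
pose eps := eps0 / (b - a + 2).
have ba2 : 0 < b - a + 2 by lra.
have eps_gt0 : 0 < eps by rewrite divr_gt0.
have epsE : eps * (b - a + 2) = eps0 by rewrite /eps divfK// gt_eqF.
have [del del_gt0 acNd] := acN _ eps_gt0.
(* The exceptional intervals, of total length below [del'], then contribute at
   most [eps] through [N] and [eps] through [U]. *)
pose del' := Num.min del (eps / (M + 1)).
have M1 : 0 < M + 1 by lra.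
have del'_gt0 : 0 < del' by rewrite lt_min del_gt0/= divr_gt0.
have Anull : lebesgue_measure A = 0%E by exact: A0.
have Afin : (lebesgue_measure A < +oo)%E by rewrite Anull.
have [W [oW AW WA]] := @lebesgue_regularity_outer R A del' mA Afin del'_gt0.
have mW : measurable W by exact: open_measurable.
have {WA}Wdel : (lebesgue_measure W < del'%:E)%E.
  apply: le_lt_trans WA.
  rewrite (_ : lebesgue_measure W =
    lebesgue_measure (W `\` A) + lebesgue_measure A)%E; last first.
    rewrite -measureU//; last 2 first.
      exact: measurableD.
      by rewrite setDE -setIA setICl setI0.
    by rewrite setUC setDUK.
  by rewrite Anull adde0.
have gauge t : a <= t <= b -> exists2 r : R, 0 < r &
   forall x y, t - r < x -> x <= t -> t <= y -> y < t + r ->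
     (N y - U y) - (N x - U x) <= eps * (y - x) \/ `[x, y] `<=` W.
  move=> tab; have [Wt|NWt] := pselect (W t).
    have /nbhs_ballP[r /= r0 rW] : nbhs t W by exact: open_nbhs_nbhs.
    exists r => // x y rx xt ty yr; right => z/=.
    rewrite in_itv/= => /andP[xz zy]; apply: rW; rewrite ball_itv/= in_itv/=.
    by apply/andP; split; lra.
  have [D D0 dD] : exists2 D : R, D <= 0 & is_derive t 1 (fun t => N t - U t) D.
    apply: contrapT => H; apply: NWt; apply: AW; apply: HA => /= K.
    by apply: H; exact: K.
  have [r r0 rP] := derive_le0_straddle dD D0 eps_gt0.
  by exists r => // x y *; left; exact: rP.
(* [good t]: the interval from [a] to [t] has been chained, [I] collecting the
   steps inside [W]. Comparing the total length with the measure of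
   [W `&` `[a, t[] keeps track of the disjointness of the steps. *)
pose good t := exists I : seq (R * R),
  [/\ all (fun ce => (a <= ce.1) && (ce.1 <= ce.2) && (ce.2 <= t)) I,
      pairwise (fun ce ce' => (ce.2 <= ce'.1) || (ce'.2 <= ce.1)) I,
      ((\sum_(ce <- I) (ce.2 - ce.1))%:E <= lebesgue_measure (W `&` `[a, t[))%E &
      (N t - U t) - (N a - U a) <= eps * (t - a) +
        \sum_(ce <- I) (`|N ce.2 - N ce.1| + M * (ce.2 - ce.1))].
have step x y : a <= x -> x <= y -> y <= b -> good x ->
    (N y - U y) - (N x - U x) <= eps * (y - x) \/ `[x, y] `<=` W -> good y.
  move=> ax xy yb [I [Iall Ipw Isum Iinc]] [H|xyW].
    exists I; split => //.
    - apply: sub_all Iall => -[c e] /= /andP[/andP[-> ->] /=] ex.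
      exact: le_trans xy.
    - apply: le_trans Isum _; apply: le_measure; rewrite ?inE.
      + by apply: measurableI => //; exact: measurable_itv.
      + by apply: measurableI => //; exact: measurable_itv.
      + by apply: setIS; apply: subset_itvl; rewrite bnd_simp.
    - lra.
  exists ((x, y) :: I); split => /=.
  - rewrite ax xy lexx/=; apply: sub_all Iall => -[c e] /= /andP[/andP[-> ->] /=] ex.
    exact: le_trans xy.
  - rewrite Ipw andbT; apply: sub_all Iall => -[c e] /= /andP[/andP[_ _] ->].
    by rewrite orbT.
  - rewrite big_cons/=.
    rewrite (_ : W `&` `[a, y[ = (W `&` `[a, x[) `|` `[x, y[); last first.
      apply/seteqP; split => z/=; rewrite !in_itv/=.
        move=> [Wz /andP[az zy]]; have [zx|xz] := ltP z x.
          by left; rewrite az.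
        by right.
      move=> [[Wz /andP[az zx]]|/andP[xz zy]].
        by split => //; rewrite az (lt_le_trans zx).
      split; last by rewrite zy (le_trans ax).
      by apply: xyW; rewrite /= in_itv/= xz ltW.
    rewrite measureU//=.
    + rewrite EFinD addeC; apply: leeD => //.
      rewrite lebesgue_measure_itv/=; case: ifPn => [_//|]; rewrite lte_fin -leNgt => yx.
      by rewrite lee_fin; lra.
    + by apply: measurableI => //; exact: measurable_itv.
    + apply/seteqP; split => z//=; rewrite !in_itv/= => -[[_ /andP[_ zx]] /andP[xz _]].
      by move: (lt_le_trans zx xz); rewrite ltxx.
  - rewrite big_cons/=.
    have := UM _ _ ax xy yb; have := ler_norm (N y - N x) => h1 h2.
    have : 0 <= eps * (y - x) by apply: mulr_ge0; lra.
    lra.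
have good_a : good a.
  exists [::]; split => //; first by rewrite big_nil.
  by rewrite big_nil; lra.
(* The supremum of the good points is good and, by its own neighbourhood, cannot
   be smaller than [b]. *)
have good_b : good b.
  pose S := [set t | a <= t <= b /\ good t].
  have Sa : S a by split => //; rewrite lexx.
  have Sub : has_ubound S by exists b => t [/andP[]].
  have Ssup : has_sup S by split => //; exists a.
  have asup : a <= sup S by exact: ub_le_sup.
  have supb : sup S <= b by apply: ge_sup; [exists a|move=> t [/andP[]]].
  have [|r r0 rP] := gauge (sup S); first by rewrite asup.
  have [t [/andP[at_ tb] gt]] := sup_adherent r0 Ssup => rt.
  have tsup : t <= sup S by apply: ub_le_sup => //; split => //; rewrite at_.
  have ext y : sup S <= y -> y < sup S + r -> y <= b -> good y.
    move=> sy yr yb; apply: (step t) => //; first exact: le_trans sy.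
    exact: rP.
  have [|sb] := leP b (sup S + r / 2).
    by move=> bs; apply: ext => //; lra.
  have g' : good (sup S + r / 2) by apply: ext; lra.
  have : sup S + r / 2 <= sup S.
    by apply: ub_le_sup => //; split => //; apply/andP; split; lra.
  by move=> ?; lra.
have [I [Iall Ipw Isum Iinc]] := good_b.
have Idel : \sum_(ce <- I) (ce.2 - ce.1) < del'.
  rewrite -lte_fin; apply: le_lt_trans Wdel; apply: le_trans Isum _.
  apply: le_measure; rewrite ?inE//.
  by apply: measurableI => //; exact: measurable_itv.
have := acNd I Iall Ipw; rewrite (lt_le_trans Idel) ?ge_min ?lexx//.
move=> /(_ isT) H.
have : M * \sum_(ce <- I) (ce.2 - ce.1) <= eps.
  apply: (@le_trans _ _ (M * (eps / (M + 1)))).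
    by apply: ler_wpM2l => //; apply: ltW; apply: lt_le_trans Idel _; rewrite ge_min lexx orbT.
  rewrite mulrCA ger_pMr// ler_pdivrMr//; lra.
move: Iinc; rewrite big_split/= -mulr_sumr => ? ?.
lra.
Qed.

(** * The Frobenius norm and its smoothing *)

(** With p, q, r the sums of a b, b^2, a^2, the sum of (q a - p b)^2 equals
    q (q r - p^2). *)
Lemma cauchy_schwarz_sum (R : realType) (I : finType) (a b : I -> R) :
  (\sum_i a i * b i) ^+ 2 <= (\sum_i a i ^+ 2) * (\sum_i b i ^+ 2).
Proof.
set p := \sum_i a i * b i; set q := \sum_i b i ^+ 2; set r := \sum_i a i ^+ 2.
have q0 : 0 <= q by apply: sumr_ge0 => i _; exact: sqr_ge0.
have H : 0 <= q * (q * r - p ^+ 2).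
  suff -> : q * (q * r - p ^+ 2) = \sum_i (q * a i - p * b i) ^+ 2.
    by apply: sumr_ge0 => i _; exact: sqr_ge0.
  transitivity (\sum_i (q ^+ 2 * a i ^+ 2 - (2 * (q * p)) * (a i * b i)
                        + p ^+ 2 * b i ^+ 2)); last first.
    by apply: eq_bigr => i _; ring.
  rewrite big_split/= sumrB -!mulr_sumr -/p -/q -/r; ring.
move: q0; rewrite le_eqVlt => /predU1P[q0|q0]; last first.
  by move: H; rewrite pmulr_rge0// subr_ge0 [r * q]mulrC.
have b0 i : b i = 0.
  apply/eqP; rewrite -sqrf_eq0.
  have : \sum_i b i ^+ 2 == 0 by rewrite -/q -q0.
  rewrite psumr_eq0; last by move=> j _; exact: sqr_ge0.
  by move=> /allP/(_ i); rewrite mem_index_enum => /(_ isT).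
rewrite /p big1 ?expr0n/=; first by rewrite mulr_ge0// ?/q -?q0// sumr_ge0// => i _; exact: sqr_ge0.
by move=> i _; rewrite b0 mulr0.
Qed.

Section frobenius.
Variables (R : realType) (m k : nat).
Implicit Types A B C : 'M[R]_(m, k).

(** The Frobenius inner product. One sum over pairs of indices makes the
    Cauchy-Schwarz inequality and the derivative rule apply directly. *)
Definition ip A B : R := \sum_(p : 'I_m * 'I_k) A p.1 p.2 * B p.1 p.2.

Definition fro A : R := Num.sqrt (ip A A).

Lemma ipC A B : ip A B = ip B A.
Proof. by apply: eq_bigr => p _; rewrite mulrC. Qed.

Lemma ipDr A B C : ip A (B + C) = ip A B + ip A C.
Proof. by rewrite -big_split; apply: eq_bigr => p _; rewrite mxE mulrDr. Qed.

Lemma ipZr c A B : ip A (c *: B) = c * ip A B.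
Proof. by rewrite mulr_sumr; apply: eq_bigr => p _; rewrite mxE mulrCA. Qed.

Lemma ipNr A B : ip A (- B) = - ip A B.
Proof. by rewrite -scaleN1r ipZr mulN1r. Qed.

Lemma ip_ge0 A : 0 <= ip A A.
Proof. by apply: sumr_ge0 => p _; rewrite -expr2 sqr_ge0. Qed.

Lemma fro_ge0 A : 0 <= fro A. Proof. exact: sqrtr_ge0. Qed.

Lemma sqr_fro A : fro A ^+ 2 = ip A A.
Proof. by rewrite sqr_sqrtr// ip_ge0. Qed.

Lemma ip_le A B : ip A B <= fro A * fro B.
Proof.
apply: le_trans (ler_norm _) _; rewrite -ler_sqr ?nnegrE ?mulr_ge0 ?fro_ge0//.
rewrite real_normK ?num_real// exprMn !sqr_fro.
exact: (@cauchy_schwarz_sum R _ (fun p => A p.1 p.2) (fun p => B p.1 p.2)).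
Qed.

Lemma ip_ge A B : - (fro A * fro B) <= ip A B.
Proof.
rewrite lerNl -ipNr; apply: le_trans (ip_le _ _) _.
by rewrite /fro ipNr ipC ipNr opprK.
Qed.

Lemma froN A : fro (- A) = fro A.
Proof. by rewrite /fro ipNr ipC ipNr opprK. Qed.

Lemma fro0 : fro 0 = 0.
Proof. by rewrite /fro /ip big1 ?sqrtr0// => p _; rewrite mxE mulr0. Qed.

Lemma fro_le A c : 0 <= c -> ip A A <= c ^+ 2 -> fro A <= c.
Proof. by move=> c0 Ac; rewrite -ler_sqr ?nnegrE ?fro_ge0// sqr_fro. Qed.

Lemma froD A B : fro (A + B) <= fro A + fro B.
Proof.
apply: fro_le; first by rewrite addr_ge0 ?fro_ge0.
rewrite ipDr [ip (A + B) A]ipC [ip (A + B) B]ipC !ipDr -!sqr_fro [ip B A]ipC.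
have := ip_le A B; nra.
Qed.

Lemma froZ c A : fro (c *: A) = `|c| * fro A.
Proof.
by rewrite /fro ipZr ipC ipZr mulrA -expr2 sqrtrM ?sqr_ge0// sqrtr_sqr.
Qed.

Lemma fro_coord A i j : `|A i j| <= fro A.
Proof.
rewrite -ler_sqr ?nnegrE ?fro_ge0// sqr_fro real_normK ?num_real//.
rewrite /ip (bigD1 (i, j))//= -expr2 lerDl.
by apply: sumr_ge0 => p _; rewrite -expr2 sqr_ge0.
Qed.

Lemma fro_eq0 A : fro A <= 0 -> A = 0.
Proof.
move=> A0; apply/matrixP => i j; rewrite mxE; apply/eqP; rewrite -normr_le0.
exact: le_trans (fro_coord _ _ _) A0.
Qed.

Lemma norm_le_fro A : `|A| <= fro A.
Proof.
rewrite /Num.Def.normr/= mx_normrE; apply: bigmax_le; first exact: fro_ge0.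
by move=> p _; exact: fro_coord.
Qed.

Lemma fro_le_norm A : fro A <= (m * k)%:R * `|A|.
Proof.
apply: fro_le; first by rewrite mulr_ge0.
apply: (@le_trans _ _ (\sum_(p : 'I_m * 'I_k) `|A| ^+ 2)).
  apply: ler_sum => p _; rewrite -expr2 -[A _ _ ^+ 2]real_normK ?num_real//.
  rewrite ler_sqr ?nnegrE//.
  by rewrite [leRHS]/Num.Def.normr/= mx_normrE; apply: (le_bigmax _ _ p).
rewrite sumr_const card_prod !card_ord -[leLHS]mulr_natl exprMn ler_wpM2r ?sqr_ge0//.
by case: (m * k)%N => [|h]; rewrite ?expr0n// ler_eXnr// ler1n.
Qed.

(** For [eps > 0], a smoothing of the Frobenius norm: differentiable everywhere,
    1-Lipschitz, and within [eps] of the norm. Being Lipschitz, it preserves absolute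
    continuity without any bound on the curve. *)
Definition rfro eps A : R := Num.sqrt (ip A A + eps ^+ 2).

Lemma fro_le_rfro eps A : fro A <= rfro eps A.
Proof. by rewrite ler_wsqrtr// lerDl sqr_ge0. Qed.

Lemma rfro_ge eps A : eps <= rfro eps A.
Proof.
by apply: le_trans (ler_norm _) _; rewrite -sqrtr_sqr ler_wsqrtr// lerDr ip_ge0.
Qed.

Lemma sqr_rfro eps A : rfro eps A ^+ 2 = ip A A + eps ^+ 2.
Proof. by rewrite sqr_sqrtr// addr_ge0 ?ip_ge0 ?sqr_ge0. Qed.

Lemma rfro_le eps A : 0 <= eps -> rfro eps A <= fro A + eps.
Proof.
move=> eps0; rewrite -ler_sqr ?nnegrE ?addr_ge0 ?fro_ge0 ?sqrtr_ge0//.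
by rewrite sqr_rfro -sqr_fro; have := fro_ge0 A; nra.
Qed.

Lemma rfro_lip eps A B : `|rfro eps A - rfro eps B| <= fro (A - B).
Proof.
suff H C D : rfro eps C - rfro eps D <= fro (C - D).
  by rewrite ler_norml lerNl opprB H -froN opprB H.
rewrite lerBlDr.
rewrite -ler_sqr ?nnegrE ?addr_ge0 ?fro_ge0 ?sqrtr_ge0// sqrrD !sqr_rfro.
have := fro_ge0 (C - D); have := fro_ge0 D; have := fro_le_rfro eps D.
have := froD (C - D) D; rewrite subrK -!sqr_fro => h1 h2 h3 h4.
have h5 : fro C ^+ 2 <= (fro (C - D) + fro D) ^+ 2.
  by rewrite ler_sqr ?nnegrE ?addr_ge0 ?fro_ge0.
nra.
Qed.

Lemma is_derive_mxE (y : R -> 'M[R]_(m, k)) (t : R) v :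
  is_derive t 1 y v <-> forall i j, is_derive t 1 (fun s => y s i j) (v i j).
Proof.
split=> [[dy yv] i j|H].
  split; first exact: (derivable_mxP _ _ _).1.
  by rewrite -yv derive_mx// mxE.
have dy : derivable y t 1.
  by apply/derivable_mxP => i j; have [] := H i j.
split => //; rewrite derive_mx//; apply/matrixP => i j; rewrite mxE.
by have [] := H i j.
Qed.

Lemma is_derive_rfro eps (y : R -> 'M[R]_(m, k)) (t : R) v : 0 < eps ->
  is_derive t 1 y v ->
  is_derive t 1 (fun s => rfro eps (y s)) (ip (y t) v / rfro eps (y t)).
Proof.
move=> eps0 /is_derive_mxE dy.
have y0 : 0 < ip (y t) (y t) + eps ^+ 2.
  by rewrite ltr_wpDl ?ip_ge0// exprn_gt0.
have dq : is_derive t 1 (fun s => ip (y s) (y s) + eps ^+ 2) (2 * ip (y t) v).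
  rewrite -[2 * _]addr0; apply: is_deriveD.
  rewrite (_ : (fun s => _) = \sum_(p : 'I_m * 'I_k)
     ((fun s => y s p.1 p.2) * (fun s => y s p.1 p.2))); last first.
    by apply/funext => s; rewrite fct_sumE.
  rewrite mulr_sumr.
  elim/big_ind2 : _ => [|f df g dg ? ?|p _]; first exact: is_derive_cst.
    exact: is_deriveD.
  have d := dy p.1 p.2.
  by apply: is_derive_eq; rewrite /GRing.scale/=; ring.
have ds := is_derive1_sqrt y0.
have dc := @is_derive1_comp R Num.sqrt
  (fun s => ip (y s) (y s) + eps ^+ 2) t _ _ ds dq.
rewrite (_ : (fun s => _) = Num.sqrt \o (fun s => ip (y s) (y s) + eps ^+ 2))//.
apply: is_derive_eq.
rewrite /rfro invfM mulrC mulrA [_ * 2^-1]mulrC mulrA mulVf ?mul1r//.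
Qed.

End frobenius.

(** * Comparison with the Euclidean operator norm *)

Lemma froE (R : realType) (m k : nat) (A : 'M[R]_(m, k)) :
  fro A ^+ 2 = \sum_i \sum_j A i j ^+ 2.
Proof. by rewrite sqr_fro pair_bigA; apply: eq_bigr => p _; rewrite expr2. Qed.

Lemma fro_tr (R : realType) (m k : nat) (A : 'M[R]_(m, k)) : fro A^T = fro A.
Proof.
apply/eqP; rewrite -(@eqrXn2 _ 2) ?fro_ge0// !froE exchange_big/=.
by under eq_bigr do under eq_bigr do rewrite mxE.
Qed.

Lemma l2norm_fro (R : realType) (k : nat) (v : 'rV[R]_k) : l2norm v = fro v.
Proof.
by rewrite -[RHS]ger0_norm ?fro_ge0// -sqrtr_sqr froE big_ord1.
Qed.

Lemma sqr_fro_rows (R : realType) (m k : nat) (A : 'M[R]_(m, k)) :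
  fro A ^+ 2 = \sum_i fro (row i A) ^+ 2.
Proof.
rewrite froE; apply: eq_bigr => i _; rewrite froE big_ord1.
by under [RHS]eq_bigr do rewrite mxE.
Qed.

Lemma fro_row (R : realType) (m k : nat) (A : 'M[R]_(m, k)) i :
  fro (row i A) <= fro A.
Proof.
rewrite -ler_sqr ?nnegrE ?fro_ge0// [leRHS]sqr_fro_rows (bigD1 i)//= lerDl.
by apply: sumr_ge0 => j _; exact: sqr_ge0.
Qed.

Lemma froM (R : realType) (m k l : nat) (A : 'M[R]_(m, k)) (B : 'M[R]_(k, l)) :
  fro (A *m B) <= fro A * fro B.
Proof.
rewrite -ler_sqr ?nnegrE ?mulr_ge0 ?fro_ge0// exprMn froE -(fro_tr B) !froE.
rewrite mulr_suml; apply: ler_sum => i _; rewrite mulr_sumr; apply: ler_sum => j _.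
rewrite mxE; apply: le_trans (cauchy_schwarz_sum _ _) _.
by under [X in _ <= _ * X]eq_bigr do rewrite mxE.
Qed.

Section opnorm_theory.
Variables (R : realType) (m k : nat).
Implicit Types A B : 'M[R]_(m, k).

Lemma opnorm_has_sup A :
  has_sup [set l2norm (A *m v^T)^T | v in [set v : 'rV[R]_k | l2norm v <= 1]].
Proof.
split.
  exists (l2norm (A *m (0 : 'rV[R]_k)^T)^T), 0 => //=.
  by rewrite l2norm_fro fro0.
exists (fro A) => _ [v /= v1 <-].
rewrite l2norm_fro fro_tr; apply: le_trans (froM _ _) _.
by rewrite ler_piMr ?fro_ge0// fro_tr -l2norm_fro.
Qed.

Lemma le_opnorm A (v : 'rV[R]_k) : fro v <= 1 -> fro (A *m v^T) <= opnorm A.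
Proof.
move=> v1; apply: ub_le_sup; first by have [] := opnorm_has_sup A.
by exists v => /=; rewrite l2norm_fro ?fro_tr.
Qed.

Lemma opnorm_le A c :
  (forall v : 'rV[R]_k, fro v <= 1 -> fro (A *m v^T) <= c) -> opnorm A <= c.
Proof.
move=> H; apply: ge_sup; first by have [] := opnorm_has_sup A.
by move=> _ [v v1 <-]; rewrite l2norm_fro fro_tr; apply: H; rewrite -l2norm_fro.
Qed.

Lemma opnorm_ge0 A : 0 <= opnorm A.
Proof.
apply: le_trans (@le_opnorm A 0 _); first exact: fro_ge0.
by rewrite fro0.
Qed.

Lemma fro_le_opnorm A : fro A <= k%:R * opnorm A.
Proof.
rewrite -ler_sqr ?nnegrE ?mulr_ge0 ?fro_ge0 ?opnorm_ge0//.
rewrite -fro_tr sqr_fro_rows.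
apply: (@le_trans _ _ (\sum_(j < k) opnorm A ^+ 2)).
  apply: ler_sum => j _; rewrite ler_sqr ?nnegrE ?fro_ge0 ?opnorm_ge0//.
  rewrite -fro_tr -tr_col trmxK colE -[delta_mx j 0]trmxK trmx_delta.
  apply: le_opnorm; apply: fro_le => //; rewrite -sqr_fro froE big_ord1.
  rewrite (bigD1 j)//= mxE !eqxx/= big1 ?addr0// => l lj.
  by rewrite mxE (negPf lj) andbF expr0n.
rewrite sumr_const card_ord -[leLHS]mulr_natl exprMn ler_wpM2r ?sqr_ge0//.
by case: (k) => [|h]; rewrite ?expr0n// ler_eXnr// ler1n.
Qed.

(** Gives the continuity of the discounted input in the tracking integral. *)
Lemma opnorm_lip A B : `|opnorm A - opnorm B| <= fro (A - B).
Proof.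
suff H (C D : 'M[R]_(m, k)) : opnorm C - opnorm D <= fro (C - D).
  by rewrite ler_norml lerNl opprB H -froN opprB H.
rewrite lerBlDr; apply: opnorm_le => v v1.
rewrite -[C in C *m _](subrK D) mulmxDl.
apply: le_trans (froD _ _) _; apply: lerD; last exact: le_opnorm.
by apply: le_trans (froM _ _) _; rewrite ler_piMr ?fro_ge0// fro_tr.
Qed.

Lemma continuous_opnorm (v : R -> 'M[R]_(m, k)) (t : R) :
  {for t, continuous v} -> {for t, continuous (fun s => opnorm (v s))}.
Proof.
move=> cv; apply/cvgrPdist_lt => e e0.
have mk0 : 0 < (m * k)%:R + 1 :> R by rewrite ltr_wpDl.
have d0 : 0 < e / ((m * k)%:R + 1) by rewrite divr_gt0.
have /cvgrPdist_lt/(_ _ d0) := cv.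
apply: filterS => s AB; apply: le_lt_trans (opnorm_lip _ _) _.
apply: le_lt_trans (fro_le_norm _) _.
apply: (@le_lt_trans _ _ (((m * k)%:R + 1) * `|v t - v s|)).
  by rewrite ler_wpM2r// lerDl.
by rewrite -ltr_pdivlMl// mulrC.
Qed.

End opnorm_theory.

(** * Caratheodory solutions and dissipativity *)

Lemma abs_continuous_sub (R : realType) (V : normedModType R) (a b c d : R)
    (f : R -> V) : a <= c -> d <= b -> abs_continuous a b f -> abs_continuous c d f.
Proof.
move=> ac db acf eps /acf[del del0 H]; exists del => // I Iall; apply: H.
apply: sub_all Iall => -[x y] /= /andP[/andP[cx ->] yd].
by rewrite (le_trans ac cx) (le_trans yd db).
Qed.

Lemma abs_continuous_lip (R : realType) (V W : normedModType R) (a b C : R)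
    (f : R -> V) (g : R -> W) :
  (forall s t, `|g t - g s| <= C * `|f t - f s|) ->
  abs_continuous a b f -> abs_continuous a b g.
Proof.
move=> gf acf eps eps0.
have C0 : 0 < `|C| + 1 by rewrite ltr_wpDl.
have [|del del0 H] := acf (eps / (`|C| + 1)); first by rewrite divr_gt0.
exists del => // I Iall Ipw /(H I Iall Ipw); rewrite ltr_pdivlMr// mulrC.
apply: le_lt_trans; rewrite mulr_sumr; apply: ler_sum => -[x y] _ /=.
apply: le_trans (gf _ _) _; rewrite ler_wpM2r//.
by apply: le_trans (ler_norm _) _; rewrite lerDl.
Qed.

Lemma abs_continuousB (R : realType) (V : normedModType R) (a b : R)
    (f g : R -> V) : abs_continuous a b f -> abs_continuous a b g ->
  abs_continuous a b (fun t => f t - g t).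
Proof.
move=> acf acg eps eps0; have e2 : 0 < eps / 2 by rewrite divr_gt0.
have [d d0 H] := acf _ e2; have [d' d'0 H'] := acg _ e2.
exists (Num.min d d') => [|I Iall Ipw]; first by rewrite lt_min d0.
rewrite lt_min => /andP[/(H I Iall Ipw) h /(H' I Iall Ipw) h'].
rewrite [eps]splitr; apply: le_lt_trans (ltrD h h').
rewrite -big_split/=; apply: ler_sum => -[x y] _ /=.
rewrite opprB [g x - _]addrC addrACA [- _ + g x]addrC.
by apply: le_trans (ler_normD _ _) _; rewrite lerD2l distrC.
Qed.

Lemma caratheodory_restrict (R : realType) (V : normedModType R) (s s' : R)
    (x v : R -> V) : s <= s' -> caratheodory s x v -> caratheodory s' x v.
Proof.
move=> ss' [acx dx]; split.
  by move=> T; exact: abs_continuous_sub (acx T).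
have FF := ae_filter_ringOfSetsType (@lebesgue_measure R).
by apply: filterS dx => t H st; apply: H; exact: le_trans st.
Qed.

Lemma caratheodory_ext (R : realType) (V : normedModType R) (s : R)
    (x v v' : R -> V) : (forall t, s <= t -> v t = v' t) ->
  caratheodory s x v -> caratheodory s x v'.
Proof.
move=> vv' [acx dx]; split => //.
have FF := ae_filter_ringOfSetsType (@lebesgue_measure R).
by apply: filterS dx => t H st; rewrite -vv'//; exact: H.
Qed.

Lemma caratheodoryB (R : realType) (V : normedModType R) (s : R)
    (x v x' v' : R -> V) : caratheodory s x v -> caratheodory s x' v' ->
  caratheodory s (fun t => x t - x' t) (fun t => v t - v' t).
Proof.
move=> [acx dx] [acx' dx']; split; first by move=> T; exact: abs_continuousB.
have FF := ae_filter_ringOfSetsType (@lebesgue_measure R).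
apply: filterS2 dx dx' => t H H' st.
by have h := H st; have h' := H' st; exact: is_deriveB.
Qed.

(** A linear map on matrices is a finite sum of coordinates with constant
    coefficients. *)
Lemma is_derive_linear (R : realType) (m k m' k' : nat)
    (f : {linear 'M[R]_(m, k) -> 'M[R]_(m', k')}) (y : R -> 'M[R]_(m, k)) (t : R) v :
  is_derive t 1 y v -> is_derive t 1 (fun s => f (y s)) (f v).
Proof.
move=> /is_derive_mxE dy; apply/is_derive_mxE => i j.
have fE (A : 'M[R]_(m, k)) : f A i j =
    \sum_(p : 'I_m * 'I_k) f (delta_mx p.1 p.2) i j * A p.1 p.2.
  rewrite {1}[A]matrix_sum_delta linear_sum summxE -(pair_bigA _ (fun a b =>
     f (delta_mx a b) i j * A a b))/=; apply: eq_bigr => a _.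
  rewrite linear_sum summxE; apply: eq_bigr => b _.
  by rewrite linearZ mxE mulrC.
rewrite fE.
rewrite (_ : (fun s => _) = \sum_(p : 'I_m * 'I_k)
     (f (delta_mx p.1 p.2) i j \*: (fun s => y s p.1 p.2))); last first.
  by apply/funext => s; rewrite fct_sumE fE.
elim/big_ind2 : _ => [|g dg h dh ? ?|p _]; first exact: is_derive_cst.
  exact: is_deriveD.
by have d := dy p.1 p.2; exact: is_deriveZ.
Qed.

Lemma caratheodory_linear (R : realType) (m k m' k' : nat)
    (f : {linear 'M[R]_(m, k) -> 'M[R]_(m', k')}) (C s : R)
    (x v : R -> 'M[R]_(m, k)) :
  (forall A, fro (f A) <= C * fro A) ->
  caratheodory s x v -> caratheodory s (fun t => f (x t)) (fun t => f (v t)).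
Proof.
move=> fC [acx dx]; split.
  move=> T; apply: (@abs_continuous_lip _ _ _ _ _ (`|C| * (m * k)%:R)
    _ _ _ (acx T)) => a b.
  rewrite -linearB; apply: le_trans (norm_le_fro _) _.
  apply: le_trans (fC _) _; rewrite -mulrA.
  apply: (@le_trans _ _ (`|C| * fro (x b - x a))).
    by rewrite ler_wpM2r ?fro_ge0// ler_norm.
  by rewrite ler_wpM2l// fro_le_norm.
have FF := ae_filter_ringOfSetsType (@lebesgue_measure R).
by apply: filterS dx => t H st; apply: is_derive_linear; exact: H.
Qed.

Lemma caratheodory_mulmx (R : realType) (m k l : nat) (A : 'M[R]_(l, m)) (s : R)
    (x v : R -> 'M[R]_(m, k)) :
  caratheodory s x v -> caratheodory s (fun t => A *m x t) (fun t => A *m v t).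
Proof.
move=> cx; apply: (@caratheodory_linear _ _ _ _ _ (mulmx A) (fro A) _ _ _ _ cx).
by move=> B; exact: froM.
Qed.

Lemma caratheodory_mulmxr (R : realType) (m k l : nat) (A : 'M[R]_(k, l)) (s : R)
    (x v : R -> 'M[R]_(m, k)) :
  caratheodory s x v -> caratheodory s (fun t => x t *m A) (fun t => v t *m A).
Proof.
move=> cx; apply: (@caratheodory_linear _ _ _ _ _ (mulmxr A) (fro A) _ _ _ _ cx).
by move=> B; rewrite mulrC; exact: froM.
Qed.

(** Zero row and column sums turn y . A y into
    - (1/2) sum_ij A_ij (y_i - y_j)^2, whose terms have a sign because the
    off-diagonal entries are nonpositive. *)
Lemma weight_balanced_ge0 (R : realType) (n d : nat) (A : 'M[R]_n)
    (y : 'M[R]_(n, d)) : weight_balanced A -> 0 <= ip y (A *m y).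
Proof.
move=> [[A0 Ac] [_ Ar]].
have -> : ip y (A *m y) = \sum_k \sum_i \sum_j A i j * (y i k * y j k).
  rewrite /ip -(pair_bigA _ (fun i k => y i k * (A *m y) i k))/= exchange_big/=.
  apply: eq_bigr => k _; apply: eq_bigr => i _; rewrite mxE mulr_sumr.
  by apply: eq_bigr => j _; ring.
apply: sumr_ge0 => k _.
have cE : \sum_i \sum_j A i j * y j k ^+ 2 = 0.
  rewrite exchange_big/= big1// => j _; rewrite -mulr_suml.
  by rewrite (Ac j) mul0r.
have rE : \sum_i \sum_j A i j * y i k ^+ 2 = 0.
  rewrite big1// => i _; rewrite -mulr_suml -[RHS](mul0r (y i k ^+ 2)).
  by congr (_ * _); rewrite -[RHS](Ar i); apply: eq_bigr => j _; rewrite mxE.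
have H : 0 <= \sum_i \sum_j (- A i j) * (y i k - y j k) ^+ 2.
  apply: sumr_ge0 => i _; apply: sumr_ge0 => j _.
  have [->|ij] := eqVneq i j; first by rewrite subrr expr0n mulr0.
  by rewrite mulr_ge0 ?sqr_ge0// oppr_ge0 A0.
suff E : \sum_i \sum_j (- A i j) * (y i k - y j k) ^+ 2 =
   2 * (\sum_i \sum_j A i j * (y i k * y j k)) - \sum_i \sum_j A i j * y i k ^+ 2
   - \sum_i \sum_j A i j * y j k ^+ 2.
  by move: H; rewrite E cE rE !subr0 pmulr_rge0.
rewrite mulr_sumr -!sumrB; apply: eq_bigr => i _.
rewrite mulr_sumr -!sumrB; apply: eq_bigr => j _; ring.
Qed.

(** For N = [rfro eps] along [w], dissipativity and Cauchy-Schwarz give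
    N' <= w . g / N <= |g| <= U'; then [eps] tends to 0. The bound on the input
    enters through a nondecreasing primitive [U], which may be an integral or
    an affine function. *)
Lemma dissipative_estimate (R : realType) (n d : nat) (L : R -> 'M[R]_n)
    (w g : R -> 'M[R]_(n, d)) (U dU : R -> R) (s b : R) :
  (forall t, 0 <= t -> weight_balanced (L t)) ->
  0 <= s -> s <= b ->
  caratheodory s w (fun t => - (L t *m w t) + g t) ->
  (forall x y, s <= x -> x <= y -> y <= b -> U x <= U y) ->
  {ae @lebesgue_measure R, forall t, s <= t <= b -> is_derive t 1 U (dU t)} ->
  (forall t, s <= t <= b -> fro (g t) <= dU t) ->
  fro (w b) <= fro (w s) + (U b - U s).
Proof.
move=> Lb s0 sb [acw dw] Umono dUae gU.
apply/ler_addgt0Pr => eps eps0.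
have : rfro eps (w b) - rfro eps (w s) <= U b - U s.
  apply: (@abs_continuous_comparison R (fun t => rfro eps (w t)) U s b 0) => //.
  - apply: (@abs_continuous_lip _ _ _ _ _ (n * d)%:R _ _ _ (acw b)) => x y.
    by apply: le_trans (rfro_lip _ _ _) _; exact: fro_le_norm.
  - by move=> x y sx xy yb; rewrite mul0r subr_le0; exact: Umono.
  - have FF := ae_filter_ringOfSetsType (@lebesgue_measure R).
    apply: filterS2 dw dUae => t dwt dUt /[dup] /dUt dUt' /[dup] tsb /andP[st tb].
    have h := is_derive_rfro eps0 (dwt st).
    have r0 : 0 < rfro eps (w t) by apply: lt_le_trans eps0 (rfro_ge _ _).
    exists (ip (w t) (- (L t *m w t) + g t) / rfro eps (w t) - dU t); last first.
      exact: is_deriveB.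
    rewrite subr_le0 ler_pdivrMr// ipDr ipNr.
    have := weight_balanced_ge0 (w t) (Lb t (le_trans s0 st)).
    have := ip_le (w t) (g t); have := gU t tsb.
    have := fro_le_rfro eps (w t); have := fro_ge0 (w t); have := fro_ge0 (g t).
    nra.
have := fro_le_rfro eps (w b).
have := rfro_le (w s) (ltW eps0).
lra.
Qed.

(** * Contraction of the flow on centred matrices *)

Definition avg_mx (R : realType) (n : nat) : 'M[R]_n := const_mx n%:R^-1.

Lemma avg_mxE (R : realType) (n d : nat) (z : 'M[R]_(n, d)) :
  avg_mx R n *m z = \matrix_(i, j) row_mean z 0 j.
Proof.
apply/matrixP => i j; rewrite !mxE summxE mulr_sumr.
by apply: eq_bigr => k _; rewrite !mxE.
Qed.

Lemma avg_mx_eq0 (R : realType) (n d : nat) (z : 'M[R]_(n, d)) (j : 'I_d) :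
  (0 < n)%N -> avg_mx R n *m z = 0 -> \sum_i z i j = 0.
Proof.
case: n z => // n z _ /matrixP/(_ 0 j); rewrite !mxE.
under eq_bigr do rewrite mxE.
rewrite -mulr_sumr => /eqP; rewrite mulf_eq0 invr_eq0 pnatr_eq0/= => /eqP.
by [].
Qed.

Lemma avg_mx_idem (R : realType) (n : nat) : (0 < n)%N ->
  avg_mx R n *m avg_mx R n = avg_mx R n.
Proof.
move=> n0; apply/matrixP => i j; rewrite !mxE.
under eq_bigr do rewrite !mxE.
rewrite sumr_const card_ord -[LHS]mulr_natl mulrA divff ?mul1r//.
by rewrite pnatr_eq0 -lt0n.
Qed.

Lemma const_mx_balanced (R : realType) (m n : nat) (c : R) (A : 'M[R]_n) :
  weight_balanced A -> (const_mx c : 'M[R]_(m, n)) *m A = 0.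
Proof.
move=> [[_ Ac] _]; apply/matrixP => i j; rewrite !mxE.
under eq_bigr do rewrite mxE.
by rewrite -mulr_sumr Ac mulr0.
Qed.

Lemma avg_mxM_balanced (R : realType) (n : nat) (A : 'M[R]_n) :
  weight_balanced A -> avg_mx R n *m A = 0.
Proof. exact: const_mx_balanced. Qed.

Lemma mulmx_avg_balanced (R : realType) (n : nat) (A : 'M[R]_n) :
  weight_balanced A -> A *m avg_mx R n = 0.
Proof.
move=> [_ [_ Ar]]; apply/matrixP => i j; rewrite !mxE.
under eq_bigr do rewrite mxE.
rewrite -mulr_suml -[RHS](mul0r n%:R^-1); congr (_ * _).
by rewrite -[RHS](Ar i); apply: eq_bigr => k _; rewrite mxE.
Qed.

Lemma rank_one_stochastic_avg (R : realType) (n : nat) : (0 < n)%N ->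
  rank_one_stochastic (avg_mx R n).
Proof.
move=> n0; have nn : n%:R != 0 :> R by rewrite pnatr_eq0 -lt0n.
split; first split=> [i j|j].
- by rewrite mxE invr_ge0.
- under eq_bigr do rewrite mxE.
  by rewrite sumr_const card_ord -[LHS]mulr_natl divff.
- have -> : avg_mx R n = (const_mx 1 : 'cV[R]_n) *m (const_mx n%:R^-1 : 'rV_n).
    by apply/matrixP => i j; rewrite !mxE big_ord1 !mxE mul1r.
  apply/eqP; rewrite eqn_leq; apply/andP; split.
    by apply: leq_trans (mxrankM_maxl _ _) _; exact: rank_leq_col.
  rewrite lt0n mxrank_eq0; apply/eqP => /matrixP/(_ (Ordinal n0) (Ordinal n0)).
  rewrite !mxE big_ord1 !mxE mul1r => /eqP; rewrite invr_eq0.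
  by rewrite (negPf nn).
Qed.

(** A rank-one matrix with unit column sums has all its columns equal, so its
    rows are constant and it annihilates matrices with zero column sums. *)
Lemma rank_one_stochastic_mul0 (R : realType) (n d : nat) (Y : 'M[R]_n)
    (z : 'M[R]_(n, d)) : (0 < n)%N ->
  rank_one_stochastic Y -> avg_mx R n *m z = 0 -> Y *m z = 0.
Proof.
move=> n0 [[_ Yc] rY] zJ.
have [c [r Ycr]] : exists (c : 'cV[R]_n) (r : 'rV[R]_n), Y = c *m r.
  have := mulmx_base Y; move: (col_base Y) (row_base Y); rewrite rY => c r H.
  by exists c, r.
have YE i j : Y i j = c i 0 * r 0 j by rewrite Ycr mxE big_ord1.
have rE j : r 0 j = (\sum_i c i 0)^-1.
  have := Yc j; under eq_bigr do rewrite YE.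
  rewrite -mulr_suml => H; apply: (mulfI (_ : \sum_i c i 0 != 0)).
    by apply/eqP => h; move: H; rewrite h mul0r => /esym/eqP; rewrite oner_eq0.
  rewrite H divff//.
  by apply/eqP => h; move: H; rewrite h mul0r => /esym/eqP; rewrite oner_eq0.
apply/matrixP => i j; rewrite !mxE.
under eq_bigr do rewrite YE rE.
by rewrite -mulr_sumr (avg_mx_eq0 _ n0 zJ) mulr0.
Qed.

Section flow.
Variables (R : realType) (n d : nat) (L : R -> 'M[R]_n) (Phi : R -> R -> 'M[R]_n).
Hypothesis n0 : (0 < n)%N.
Hypothesis Lb : forall t, 0 <= t -> weight_balanced (L t).
Hypothesis flow : is_flow L Phi.
Implicit Types (w z e g : R -> 'M[R]_(n, d)) (y : 'M[R]_(n, d)).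

(** Since linear combinations of solutions are solutions, this is also the
    uniqueness statement for the homogeneous equation. *)
Lemma homogeneous_le w s b : 0 <= s -> s <= b ->
  caratheodory s w (fun t => - (L t *m w t)) -> fro (w b) <= fro (w s).
Proof.
move=> s0 sb cw; rewrite -[leRHS]addr0 -[X in _ + X](subrr (0 : R)).
apply: (@dissipative_estimate _ _ _ L w (fun=> 0) (fun=> 0) (fun=> 0)) => //.
- by apply: caratheodory_ext cw => t _; rewrite addr0.
- have FF := ae_filter_ringOfSetsType (@lebesgue_measure R).
  by apply: nearW => t _; exact: is_derive_cst.
- by move=> t _; rewrite fro0.
Qed.

Lemma caratheodory_flow y s : 0 <= s ->
  caratheodory s (fun t => Phi t s *m y) (fun t => - (L t *m (Phi t s *m y))).
Proof.
move=> s0; have [_ c] := flow s0.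
apply: caratheodory_ext (caratheodory_mulmxr y c) => t _.
by rewrite mulNmx mulmxA.
Qed.

Lemma flow_semigroup y s r t : 0 <= s -> s <= r -> r <= t ->
  Phi t r *m (Phi r s *m y) = Phi t s *m y.
Proof.
move=> s0 sr rt; have r0 := le_trans s0 sr.
apply/eqP; rewrite -subr_eq0; apply/eqP; apply: fro_eq0.
have c1 := caratheodory_flow (Phi r s *m y) r0.
have c2 := caratheodory_restrict sr (caratheodory_flow y s0).
have := homogeneous_le r0 rt (caratheodory_ext _ (caratheodoryB c1 c2)).
rewrite (flow r0).1 mul1mx subrr fro0; apply => x _.
by rewrite mulmxBr opprB opprK addrC.
Qed.

(** The averaged solution solves the homogeneous equation too, both sides being
    0, and it starts from 0. *)
Lemma avg_flow y s t : 0 <= s -> s <= t -> avg_mx R n *m y = 0 ->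
  avg_mx R n *m (Phi t s *m y) = 0.
Proof.
move=> s0 st y0; apply: fro_eq0.
have c := caratheodory_mulmx (avg_mx R n) (caratheodory_flow y s0).
have := homogeneous_le s0 st (caratheodory_ext _ c).
rewrite (flow s0).1 mul1mx y0 fro0; apply => x sx.
have x0 := Lb (le_trans s0 sx).
rewrite mulmxN !mulmxA avg_mxM_balanced// mulmx_avg_balanced//.
Qed.

Lemma avg_solution e g t : 0 <= t ->
  caratheodory 0 e (fun t => - (L t *m e t) + g t) ->
  avg_mx R n *m e 0 = 0 -> (forall t, 0 <= t -> avg_mx R n *m g t = 0) ->
  avg_mx R n *m e t = 0.
Proof.
move=> t0 ce e0 g0; apply: fro_eq0.
have c := caratheodory_mulmx (avg_mx R n) ce.
have := homogeneous_le (lexx 0) t0 (caratheodory_ext _ c).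
rewrite e0 fro0; apply => x x0.
have Lx := Lb x0.
rewrite mulmxDr mulmxN !mulmxA avg_mxM_balanced// mulmx_avg_balanced//.
by rewrite g0// !mul0mx addr0.
Qed.

(** One step of variation of constants: the defect starts from 0 and solves
    the equation with input [g]. *)
Lemma defect_le e g (U dU : R -> R) (s b : R) : 0 <= s -> s <= b ->
  caratheodory 0 e (fun t => - (L t *m e t) + g t) ->
  (forall q r, s <= q -> q <= r -> r <= b -> U q <= U r) ->
  {ae @lebesgue_measure R, forall t, s <= t <= b -> is_derive t 1 U (dU t)} ->
  (forall t, s <= t <= b -> fro (g t) <= dU t) ->
  fro (e b - Phi b s *m e s) <= U b - U s.
Proof.
move=> s0 sb ce Um dUae gU.
have c1 := caratheodory_restrict s0 ce.
have c2 := caratheodory_flow (e s) s0.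
have := dissipative_estimate Lb s0 sb (caratheodory_ext _ (caratheodoryB c1 c2)) Um dUae gU.
rewrite (flow s0).1 mul1mx subrr fro0 add0r; apply => x _.
by rewrite mulmxBr opprB opprK addrAC; congr (_ + _); rewrite addrC.
Qed.

(** A rank-one stochastic [Y] near [Phi t s] satisfies [Y *m y = 0], so
    [Phi t s *m y = (Phi t s - Y) *m y]. The factor 2 in the constant pays for
    the infimum in the distance to the rank-one stochastic matrices possibly
    not being attained. *)
Lemma flow_contraction : weakly_exp_ergodic Phi ->
  exists C lam : R, [/\ 0 < lam < 1, 0 < C &
    forall s t y, 0 <= s -> s <= t -> avg_mx R n *m y = 0 ->
      fro (Phi t s *m y) <= C * lam `^ (t - s) * fro y].
Proof.
move=> [lam [a [/andP[l0 l1] a0 H]]].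
exists (n%:R * (2 * a)), lam; split; [by rewrite l0|by rewrite !mulr_gt0// ltr0n|].
move=> s t y s0 st yJ.
set S := [set opnorm (Phi t s - Y) | Y in @rank_one_stochastic R n].
have hS : has_inf S.
  split; first by exists (opnorm (Phi t s - avg_mx R n)), (avg_mx R n) => //;
    exact: rank_one_stochastic_avg.
  by exists 0 => _ [Y _ <-]; exact: opnorm_ge0.
have p0 : 0 < a * lam `^ (t - s) by rewrite mulr_gt0// powR_gt0.
have [_ [Y YS <-] HY] := inf_adherent p0 hS.
have {}HY : opnorm (Phi t s - Y) <= 2 * (a * lam `^ (t - s)).
  apply: (le_trans (ltW HY)); rewrite mulr_natl mulr2n lerD2r; exact: H.
have -> : Phi t s *m y = (Phi t s - Y) *m y.
  by rewrite mulmxBl (rank_one_stochastic_mul0 n0 YS yJ) subr0.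
apply: le_trans (froM _ _) _; rewrite ler_wpM2r ?fro_ge0//.
apply: le_trans (fro_le_opnorm _) _.
by rewrite -!mulrA ler_wpM2l.
Qed.

(** Discrete variation of constants. The solution at time [tt m.+1] is the flow
    of the one at [tt m] plus a defect; the semigroup law carries the first term
    to time [t], and the contraction bounds the second, which is centred. *)
Lemma tracking_sum e g (C lam : R) (tt del : nat -> R) :
  0 < lam -> 0 <= C ->
  (forall s t y, 0 <= s -> s <= t -> avg_mx R n *m y = 0 ->
      fro (Phi t s *m y) <= C * lam `^ (t - s) * fro y) ->
  caratheodory 0 e (fun t => - (L t *m e t) + g t) ->
  avg_mx R n *m e 0 = 0 -> (forall t, 0 <= t -> avg_mx R n *m g t = 0) ->
  tt 0%N = 0 -> (forall k, tt k <= tt k.+1) ->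
  (forall k, fro (e (tt k.+1) - Phi (tt k.+1) (tt k) *m e (tt k)) <= del k) ->
  forall m t, tt m <= t -> fro (Phi t (tt m) *m e (tt m)) <=
    C * (lam `^ t * fro (e 0) + \sum_(k < m) lam `^ (t - tt k.+1) * del k).
Proof.
move=> l0 C0 HC ce e0 g0 tt0 ttS Hdel.
have ttge k : 0 <= tt k.
  by elim: k => [|k IH]; [rewrite tt0|exact: le_trans (ttS k)].
elim=> [|m IH] t tmt.
  rewrite big_ord0 addr0 tt0 mulrA -{2}[t]subr0.
  by apply: HC => //; rewrite -tt0.
(* The defect is centred because the solution and the flow both preserve
   centredness. *)
set w := e (tt m.+1) - Phi (tt m.+1) (tt m) *m e (tt m).
have wJ : avg_mx R n *m w = 0.
  rewrite mulmxBr (avg_solution (ttge _) ce)// avg_flow// ?subrr//.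
  exact: (avg_solution (ttge _) ce).
have -> : e (tt m.+1) = Phi (tt m.+1) (tt m) *m e (tt m) + w.
  by rewrite addrC subrK.
rewrite mulmxDr flow_semigroup// big_ord_recr/= addrA mulrDr.
apply: le_trans (froD _ _) _; apply: lerD.
  by apply: IH; exact: le_trans (ttS m) _.
apply: le_trans (HC _ _ _ (ttge _) tmt wJ) _.
by rewrite -mulrA ler_wpM2l// ler_wpM2l ?powR_ge0//; exact: Hdel.
Qed.

End flow.

(** * Tracking bound for continuous inputs *)

(** The orthogonal projection onto matrices with zero column sums. *)
Definition centering_mx (R : realType) (n : nat) : 'M[R]_n := 1%:M - avg_mx R n.

Lemma row_center (R : realType) (n d : nat) (y : 'M[R]_(n, d)) i :
  row i (centering_mx R n *m y) = row i y - row_mean y.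
Proof.
by apply/rowP => j; rewrite mulmxBl mul1mx avg_mxE !mxE.
Qed.

Lemma avg_center (R : realType) (n d : nat) (y : 'M[R]_(n, d)) : (0 < n)%N ->
  avg_mx R n *m (centering_mx R n *m y) = 0.
Proof.
by move=> n0; rewrite mulmxA mulmxBr mulmx1 avg_mx_idem// subrr mul0mx.
Qed.

Lemma row_meanE (R : realType) (n d : nat) (y : 'M[R]_(n, d)) :
  row_mean y = (const_mx n%:R^-1 : 'rV[R]_n) *m y.
Proof.
apply/rowP => j; rewrite !mxE summxE mulr_sumr.
by apply: eq_bigr => k _; rewrite !mxE.
Qed.

Lemma center_solution (R : realType) (n d : nat) (L : R -> 'M[R]_n)
    (x u : R -> 'M[R]_(n, d)) :
  (forall t, 0 <= t -> weight_balanced (L t)) ->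
  caratheodory 0 x (fun t => - (L t *m x t) + u t) ->
  caratheodory 0 (fun t => centering_mx R n *m x t)
    (fun t => - (L t *m (centering_mx R n *m x t)) + centering_mx R n *m u t).
Proof.
move=> Lb cx; apply: caratheodory_ext (caratheodory_mulmx (centering_mx R n) cx) => t t0.
have Lt := Lb t t0.
rewrite mulmxDr mulmxN; congr (- _ + _).
rewrite !mulmxA mulmxBl mulmxBr mul1mx mulmx1.
by rewrite avg_mxM_balanced// mulmx_avg_balanced.
Qed.

Lemma caratheodory_row_mean (R : realType) (n d : nat) (L : R -> 'M[R]_n)
    (x u : R -> 'M[R]_(n, d)) :
  (forall t, 0 <= t -> weight_balanced (L t)) ->
  caratheodory 0 x (fun t => - (L t *m x t) + u t) ->
  caratheodory 0 (fun t => row_mean (x t))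
    (fun t => n%:R^-1 *: \sum_(i < n) row i (u t)).
Proof.
move=> Lb cx; have := caratheodory_mulmx (const_mx n%:R^-1 : 'rV[R]_n) cx.
under eq_fun do rewrite -row_meanE.
apply: caratheodory_ext => t t0.
rewrite mulmxDr mulmxN mulmxA const_mx_balanced; last exact: Lb.
by rewrite mul0mx oppr0 add0r -row_meanE.
Qed.

Section primitive.
Variables (R : realType) (h : R -> R).
Hypothesis hc : forall t, {for t, continuous h}.
Hypothesis h0 : forall t, 0 <= h t.

Let G (t : R) : R := \int[@lebesgue_measure R]_(s in `[0%R, t]) h s.

Let hint (a b : R) : (@lebesgue_measure R).-integrable `[a, b] (EFin \o h).
Proof.
apply: continuous_compact_integrable; first exact: segment_compact.
by apply: continuous_subspaceT => t; exact: hc.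
Qed.

Lemma primitive_mono (a b : R) : 0 <= a -> a <= b -> G a <= G b.
Proof.
move=> a0 ab; rewrite -subr_ge0.
rewrite (@Rintegral_itvB R h (BLeft 0) (BRight b) a)//.
by apply: Rintegral_ge0 => t _; exact: h0.
Qed.

(** Only interior points: at 0 the primitive, which vanishes on the negative
    half-line, need not be differentiable. *)
Lemma is_derive_primitive (t : R) : 0 < t -> is_derive t 1 G (h t).
Proof.
move=> t0.
have tt1 : t < t + 1 by rewrite ltrDl.
have [dG GE] := continuous_FTC1_closed tt1 (hint 0 (t + 1)) t0 (@hc t).
by apply: DeriveDef; [exact: dG|rewrite -GE derive1E].
Qed.

Lemma primitive0 : G 0 = 0.
Proof. by rewrite /G set_itv1 Rintegral_set1. Qed.

End primitive.

Lemma ae_neq (R : realType) (a : R) : {ae @lebesgue_measure R, forall t, t != a}.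
Proof.
exists [set a]; split => //; first exact: lebesgue_measure_set1.
by move=> t /= /negP; rewrite negbK => /eqP.
Qed.

Lemma continuous_discount (R : realType) (lam T t : R) : 0 < lam ->
  {for t, continuous (fun s => lam `^ (T - s))}.
Proof.
move=> l0.
rewrite (_ : (fun s => _) = expR \o (fun s => (T - s) * ln lam)); last first.
  by apply/funext => s; rewrite /powR gt_eqF.
apply: continuous_comp; last exact: continuous_expR.
apply: cvgMl; apply: cvgB; [exact: cvg_cst|exact: cvg_id].
Qed.

Section output.
Variables (R : realType) (n d : nat) (L : R -> 'M[R]_n) (Phi : R -> R -> 'M[R]_n).
Hypothesis n0 : (0 < n)%N.
Hypothesis Lb : forall t, 0 <= t -> weight_balanced (L t).
Hypothesis flow : is_flow L Phi.
Variables (C lam : R).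
Hypotheses (l0 : 0 < lam) (l1 : lam < 1) (C0 : 0 < C).
Hypothesis HC : forall s t (y : 'M[R]_(n, d)), 0 <= s -> s <= t ->
   avg_mx R n *m y = 0 -> fro (Phi t s *m y) <= C * lam `^ (t - s) * fro y.

(** The partition is [k * (T / m)] with [m > T]. On step [k] the primitive used
    to bound the defect is, up to a constant factor, [lam^(tt k - T)] times that
    of the discounted input,
    whose derivative dominates the input there; after transport to time [T] each
    increment is multiplied by [lam^(tt k - tt k.+1) <= 1 / lam], and the
    increments telescope. *)
Lemma output_tracking (x u v : R -> 'M[R]_(n, d)) (T : R) :
  0 <= T ->
  caratheodory 0 x (fun t => - (L t *m x t) + u t) ->
  (forall t, 0 <= t -> u t = v t) ->
  (forall t, {for t, continuous v}) ->
  fro (centering_mx R n *m x T) <=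
    C * (fro (centering_mx R n) * d%:R) / lam * (lam `^ T * opnorm (x 0) +
      \int[@lebesgue_measure R]_(s in `[0%R, T]) (lam `^ (T - s) * opnorm (v s))).
Proof.
move=> T0 cx uv vc.
set e := fun t => centering_mx R n *m x t.
have ce := center_solution Lb cx.
pose h s := lam `^ (T - s) * opnorm (v s).
have hc t : {for t, continuous h}.
  by apply: continuousM; [exact: continuous_discount|exact: continuous_opnorm].
have h0 t : 0 <= h t by rewrite mulr_ge0 ?powR_ge0 ?opnorm_ge0.
pose G (t : R) : R := \int[@lebesgue_measure R]_(s in `[0%R, t]) h s.
rewrite -/(G T).
pose m := Num.bound T.
have Tm : T < m%:R by exact: archi_boundP.
have m0 : 0 < m%:R :> R by exact: le_lt_trans Tm.
pose tt (k : nat) : R := k%:R * (T / m%:R).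
have tt0 : tt 0%N = 0 by rewrite /tt mul0r.
have dt0 : 0 <= T / m%:R by rewrite divr_ge0// ltW.
have dt1 : T / m%:R <= 1 by rewrite ler_pdivrMr// mul1r ltW.
have ttSE k : tt k.+1 - tt k = T / m%:R by rewrite /tt -mulrBl -natrB// subSnn mul1r.
have ttS k : tt k <= tt k.+1 by rewrite -subr_ge0 ttSE.
have ttge k : 0 <= tt k by rewrite mulr_ge0.
have ttm : tt m = T by rewrite /tt mulrC divfK// gt_eqF.
pose K := fro (centering_mx R n) * d%:R.
have K0 : 0 <= K by rewrite mulr_ge0 ?fro_ge0.
have frou (y : 'M[R]_(n, d)) : fro (centering_mx R n *m y) <= K * opnorm y.
  by apply: le_trans (froM _ _) _; rewrite -mulrA ler_wpM2l ?fro_ge0// fro_le_opnorm.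
pose c k := K * lam `^ (tt k - T).
have c0 k : 0 <= c k by rewrite mulr_ge0 ?powR_ge0.
pose del k := c k * G (tt k.+1) - c k * G (tt k).
have defect k : fro (e (tt k.+1) - Phi (tt k.+1) (tt k) *m e (tt k)) <= del k.
  apply: (@defect_le _ _ _ L Phi Lb flow e _ (fun t => c k * G t)
    (fun t => c k * h t) _ _ _ _ ce) => //.
  - move=> q r tq qr _; rewrite ler_wpM2l//.
    by apply: primitive_mono => //; exact: le_trans tq.
  - have FF := ae_filter_ringOfSetsType (@lebesgue_measure R).
    apply: filterS (ae_neq 0) => t tn0 /andP[tt' _].
    have t0 : 0 < t by rewrite lt_neqAle eq_sym tn0 (le_trans (ttge k)).
    by have dG := is_derive_primitive hc t0; exact: is_deriveZ.
  - move=> t /andP[tkt _]; have t0 := le_trans (ttge k) tkt.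
    apply: le_trans (frou _) _; rewrite uv// /c /h -mulrA ler_wpM2l// mulrA.
    rewrite -powRD; last by rewrite (gt_eqF l0) implybT.
    rewrite ler_peMl ?opnorm_ge0//.
    rewrite subrKA -(@powRr0 _ lam).
    rewrite /powR (gt_eqF l0) ler_expR; apply: ler_wnM2r.
      by rewrite ln_le0// ltW.
    by rewrite subr_le0.
have := tracking_sum Lb flow l0 (ltW C0) HC ce (avg_center _ n0) _ tt0 ttS defect (t := T) (m := m).
rewrite ttm (flow T0).1 mul1mx => /(_ _ (lexx _)) H.
apply: le_trans (H _) _; first by move=> t _; exact: avg_center.
have -> : C * (fro (centering_mx R n) * d%:R) / lam = C * (lam^-1 * K).
  by rewrite /K; ring.
rewrite -[leRHS]mulrA ler_wpM2l ?(ltW C0)// [leRHS]mulrDr; apply: lerD.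
  apply: (@le_trans _ _ (lam `^ T * (K * opnorm (x 0)))).
    by rewrite ler_wpM2l ?powR_ge0// frou.
  rewrite (_ : lam^-1 * K * _ = lam^-1 * (lam `^ T * (K * opnorm (x 0)))); last by ring.
  rewrite ler_peMl ?mulr_ge0 ?powR_ge0 ?opnorm_ge0 ?fro_ge0//.
  by rewrite invf_ge1// ltW.
apply: (@le_trans _ _ (\sum_(k < m) lam^-1 * K * (G (tt k.+1) - G (tt k)))); last first.
  rewrite -mulr_sumr -(big_mkord xpredT (fun k => G (tt k.+1) - G (tt k))).
  by rewrite (@telescope_sumr _ 0 m (fun k => G (tt k)))// ttm tt0 /G primitive0 subr0.
apply: ler_sum => k _; rewrite /del -mulrBr /c.
rewrite mulrA ler_wpM2r//; first by rewrite subr_ge0 primitive_mono.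
rewrite mulrCA [leRHS]mulrC ler_wpM2l//.
rewrite -powRD; last by rewrite (gt_eqF l0) implybT.
rewrite -powR_inv1 ?(ltW l0)//.
rewrite [X in lam `^ X]addrC subrKA /powR (gt_eqF l0) ler_expR; apply: ler_wnM2r.
  by rewrite ln_le0// ltW.
by rewrite -[tt k - _]opprB ttSE lerN2.
Qed.

End output.

(** * The Laplacian dynamics is a flow tracker *)

(** Off the edges the coefficient [L t i j] is 0, so the varied coordinate has
    no effect and each function differentiated is constant. *)
Lemma laplacian_respects_graph (R : realType) (n d : nat) (L : R -> 'M[R]_n) :
  respects_graph (laplacian_dynamics d L) (laplacian_graph L).
Proof.
move=> t i j t0; rewrite negb_or negbK => /andP[ij /eqP Lij] x w.
have cst' (V : normedModType R) (f : R -> V) : (forall s, f s = f 0) -> is_derive (0 : R) 1 f 0.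
  move=> fE; rewrite (_ : f = cst (f 0)); first exact: is_derive_cst.
  by apply/funext => s; rewrite fE.
split; [move=> v; split|split].
- move=> a; apply: cst' => s /=; congr (- _ + _).
  rewrite !row_mul !mulmxDr; congr (_ + _); rewrite scale0r mulmx0 -scalemxAr.
  rewrite (_ : _ *m _ = 0) ?scaler0//.
  apply/rowP => b; rewrite !mxE big1// => k _; rewrite !mxE.
  by have [->|] := eqVneq k j; rewrite ?Lij ?mul0r ?mulr0.
- by case.
- by move=> a; apply: cst' => s; apply/rowP; case.
- by case.
Qed.

Lemma laplacian_solution (R : realType) (n d : nat) (L : R -> 'M[R]_n)
  (u x : R -> 'M[R]_(n, d)) (w : R -> 'rV[R]_(\sum_i wdim (laplacian_dynamics d L) i)) :
  dyn_solution u x w -> caratheodory 0 x (fun t => - (L t *m x t) + u t).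
Proof.
move=> [cx _]; apply: caratheodory_ext cx => t _.
by apply/row_matrixP => i; rewrite rowK/= linearD linearN.
Qed.

Lemma laplacian_tracker (R : realType) (n d : nat) (L : R -> 'M[R]_n)
    (Phi : R -> R -> 'M[R]_n) : (0 < n)%N ->
  (forall t, 0 <= t -> weight_balanced (L t)) ->
  is_flow L Phi -> weakly_exp_ergodic Phi ->
  distributed_flow_tracker (D := laplacian_dynamics d L) (laplacian_graph L) setT.
Proof.
move=> n0 Lb flow erg; split; first exact: laplacian_respects_graph.
  exists n%:R^-1; first by rewrite invr_gt0 ltr0n.
  by move=> u x w /laplacian_solution; exact: caratheodory_row_mean.
move=> u [v dv uv].
have [C [lam [/andP[l0 l1] C0 HC]]] := @flow_contraction _ _ d _ n0 erg.
have vc t : {for t, continuous v}.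
  by apply/differentiable_continuous/derivable1_diffP; exact: (dv 0%N).
pose c2 := C * (fro (centering_mx R n) * d%:R) / lam.
have c20 : 0 <= c2 by rewrite divr_ge0 ?mulr_ge0 ?fro_ge0// ltW.
exists lam, (c2 + 1); split; [by rewrite ltW|by rewrite ltr_wpDl|].
move=> x w /laplacian_solution cx _ i t t0.
rewrite /dyn_output /= -row_center l2norm_fro.
apply: le_trans (fro_row _ _) _.
apply: le_trans (output_tracking n0 Lb flow l0 l1 C0 HC t0 cx uv vc) _.
rewrite -/c2.
have -> : \int[lebesgue_measure]_(s in `[0, t]) (lam `^ (t - s) * opnorm (u s)) =
          \int[lebesgue_measure]_(s in `[0, t]) (lam `^ (t - s) * opnorm (v s)).
  apply: eq_Rintegral => s; rewrite inE/= in_itv/= => /andP[s0 _].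
  by rewrite uv.
rewrite ler_wpM2r ?lerDl// addr_ge0// ?mulr_ge0 ?powR_ge0 ?opnorm_ge0//.
by apply: Rintegral_ge0 => s _; rewrite mulr_ge0 ?powR_ge0 ?opnorm_ge0.
Qed.

(** * Convexity, step-size series and real sequences *)

Lemma derive_grad (R : realType) (d : nat) (f : 'rV[R]_d -> R) (z v : 'rV[R]_d) :
  differentiable f z -> 'D_v f z = ip (grad f z) v.
Proof.
move=> df; rewrite deriveE//.
rewrite [v in LHS]row_sum_delta linear_sum /ip.
rewrite -(pair_bigA _ (fun i j => grad f z i j * v i j))/= big_ord1.
by apply: eq_bigr => j _; rewrite linearZ/= mxE deriveE// mulrC.
Qed.

(** The difference quotients of [f] from [z] towards [y] are at most
    [f y - f z], and so is their limit. *)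
Lemma convex_grad_le (R : realType) (d : nat) (f : 'rV[R]_d -> R) (z y : 'rV[R]_d) :
  convex_function (setT : set (convex_lmodType 'rV[R]_d)) f ->
  differentiable f z -> f z + ip (grad f z) (y - z) <= f y.
Proof.
move=> cf df; rewrite -derive_grad//; set D := 'D_(y - z) f z.
rewrite leNgt; apply/negP => fyD.
have e0 : 0 < D - (f y - f z) by lra.
have dD : derivable f z (y - z) by exact: diff_derivable.
have : h^-1 *: (f (h *: (y - z) + z) - f z) @[h --> 0^'] --> D by exact: dD.
move=> /cvgrPdist_lt/(_ _ e0)[r /= r0 rP].
pose h := Num.min (r / 2) 1.
have h0 : 0 < h by rewrite lt_min ltr01 divr_gt0.
have h1 : h <= 1 by rewrite ge_min lexx orbT.
have hr : h < r by rewrite gt_min ltr_pdivrMr// ltr_pMr// ltr1n.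
have := rP h; rewrite /ball_/= sub0r normrN gtr0_norm// => /(_ hr (lt0r_neq0 h0)).
move=> /ltr_normlW; rewrite ltrBlDr -ltrBlDl opprB addrC subrK; apply/negP.
set fh := f (h *: (y - z) + z).
rewrite -leNgt -[h^-1 *: _]/(h^-1 * (fh - f z)) ler_pdivrMl//.
have : fh <= h * f y + (1 - h) * f z.
  rewrite /fh (_ : h *: (y - z) + z = h *: y + (1 - h) *: z); last first.
    by rewrite scalerBr scalerBl scale1r -!addrA [- _ + z]addrC.
  by have := cf (Itv01 (ltW h0) h1) y z; rewrite !inE; apply.
lra.
Qed.

Section sum_integral.
Variables (R : realType) (b : R -> R).
Hypothesis b0 : forall t, 0 <= b t.
Hypothesis b_mono : forall s t, s <= t -> b t <= b s.

Let mb (D : set R) : measurable D -> measurable_fun D (EFin \o b).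
Proof.
by move=> mD; apply/measurable_EFinP; apply: nonincreasing_measurable => // s t; exact: b_mono.
Qed.

Let F (k : nat) : set R := `[k%:R, k.+1%:R[%classic.

Let muF k : lebesgue_measure (F k) = 1%E.
Proof.
rewrite /F lebesgue_measure_itv/= lte_fin ltr_nat ltnSn -EFinB.
by rewrite -natrB// subSnn.
Qed.

Let mF k : measurable (F k). Proof. exact: measurable_itv. Qed.

(** Splitting the half-line into unit intervals turns both integral conditions
    on the step size into conditions on series of its values at the integers. *)
Lemma integral_unit_series :
  (\int[@lebesgue_measure R]_(t in `[0%R, +oo[) (b t)%:E =
   \sum_(k <oo) \int[@lebesgue_measure R]_(t in F k) (b t)%:E)%E.
Proof.
rewrite -ge0_integral_bigcup//.
- congr (integral _ _ _); apply/seteqP; split => t /=.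
    rewrite in_itv/= andbT => /truncn_itv /andP[h1 h2].
    by exists (Num.truncn t) => //=; rewrite /F /= in_itv/= h1.
  by move=> [k _]; rewrite /F/= !in_itv/= andbT => /andP[+ _]; apply: le_trans.
- apply: mb; apply: bigcup_measurable => k _; exact: mF.
- by move=> t _; rewrite lee_fin.
- apply/trivIsetP => i j _ _ ij; apply/seteqP; split => // t [].
  rewrite /F /= !in_itv/= => /andP[it ti] /andP[jt tj].
  have h1 := le_lt_trans it tj; have h2 := le_lt_trans jt ti.
  by move: h1 h2 ij; rewrite !ltr_nat !ltnS eqn_leq => -> ->.
Qed.

Let int_le k : (\int[@lebesgue_measure R]_(t in F k) (b t)%:E <= (b k%:R)%:E)%E.
Proof.
rewrite -[leRHS]mule1 -(muF k) -integral_cst; last exact: mF.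
apply: ge0_le_integral => //.
- exact: mF.
- by move=> t _; rewrite lee_fin.
- by apply: mb; exact: mF.
- by move=> t; rewrite /F/= in_itv/= => /andP[kt _]; rewrite lee_fin b_mono.
Qed.

Let int_ge k : ((b k.+1%:R)%:E <= \int[@lebesgue_measure R]_(t in F k) (b t)%:E)%E.
Proof.
rewrite -[leLHS]mule1 -(muF k) -integral_cst; last exact: mF.
apply: ge0_le_integral => //.
- exact: mF.
- by move=> t _; rewrite lee_fin.
- by apply: mb; exact: mF.
- by move=> t; rewrite /F/= in_itv/= => /andP[_ /ltW kt]; rewrite lee_fin b_mono.
Qed.

Lemma sum_bounded_of_integral :
  (\int[@lebesgue_measure R]_(t in `[0%R, +oo[) (b t)%:E < +oo)%E ->
  exists A, forall N : nat, \sum_(k < N) b k.+1%:R <= A.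
Proof.
rewrite integral_unit_series => fin.
set I := (X in (X < _)%E) in fin.
have I0 : (0 <= I)%E.
  by apply: nneseries_ge0 => k _ _; apply: integral_ge0 => t _; rewrite lee_fin.
exists (fine I) => N; rewrite -lee_fin fineK ?ge0_fin_numE//.
rewrite -sumEFin -(big_mkord xpredT (fun k => (b k.+1%:R)%:E)).
apply: (@le_trans _ _ (\sum_(0 <= k < N) \int[@lebesgue_measure R]_(t in F k) (b t)%:E)%E).
  by apply: lee_sum => k _; exact: int_ge.
by apply: nneseries_lim_ge => k _ _; apply: integral_ge0 => t _; rewrite lee_fin.
Qed.

Lemma sum_unbounded_of_integral :
  (\int[@lebesgue_measure R]_(t in `[0%R, +oo[) (b t)%:E = +oo)%E ->
  forall B : R, exists N : nat, B < \sum_(k < N) b k%:R.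
Proof.
rewrite integral_unit_series => inf B; apply: contrapT => H.
have {}H N : \sum_(k < N) b k%:R <= B.
  by rewrite leNgt; apply/negP => h; apply: H; exists N.
suff : (\sum_(k <oo) \int[@lebesgue_measure R]_(t in F k) (b t)%:E <= B%:E)%E.
  by rewrite inf leye_eq.
apply: lime_le.
  by apply: is_cvg_nneseries => k _ _; apply: integral_ge0 => t _; rewrite lee_fin.
apply: nearW => N.
apply: (@le_trans _ _ (\sum_(0 <= k < N) (b k%:R)%:E)%E).
  by apply: lee_sum => k _; exact: int_le.
by rewrite big_mkord sumEFin lee_fin.
Qed.

End sum_integral.

(** By convexity of the square, (lam S + c a)^2 <= lam S^2 + c^2 a^2 / (1 - lam);
    summing and absorbing the first term bounds the sum of the squares. *)
Lemma sqr_sum_recursion (R : realType) (a S : nat -> R) (lam c A : R) :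
  0 < lam -> lam < 1 -> (forall k, 0 <= S k) ->
  (forall N : nat, \sum_(k < N) a k ^+ 2 <= A) ->
  (forall k, S k.+1 <= lam * S k + c * a k) ->
  exists B, forall N : nat, \sum_(k < N) S k ^+ 2 <= B.
Proof.
move=> l0 l1 S0 aA Srec.
have m0 : 0 < 1 - lam by rewrite subr_gt0.
pose c' := c ^+ 2 / (1 - lam).
have c'0 : 0 <= c' by rewrite divr_ge0 ?sqr_ge0// ltW.
have step k : S k.+1 ^+ 2 <= lam * S k ^+ 2 + c' * a k ^+ 2.
  apply: (@le_trans _ _ ((lam * S k + c * a k) ^+ 2)).
    by rewrite ler_sqr ?nnegrE// (le_trans (S0 k.+1)).
  rewrite -subr_ge0.
  have -> : lam * S k ^+ 2 + c' * a k ^+ 2 - (lam * S k + c * a k) ^+ 2 =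
    lam / (1 - lam) * ((1 - lam) * S k - c * a k) ^+ 2.
    by rewrite /c'; field; rewrite gt_eqF.
  by rewrite mulr_ge0 ?sqr_ge0// divr_ge0// ltW.
pose Q N := \sum_(k < N) S k ^+ 2.
have QS N : Q N.+1 <= S 0%N ^+ 2 + lam * Q N + c' * A.
  rewrite /Q big_ord_recl/= -addrA lerD2l.
  apply: (@le_trans _ _ (\sum_(k < N) (lam * S k ^+ 2 + c' * a k ^+ 2))).
    by apply: ler_sum => k _; exact: step.
  by rewrite big_split/= -!mulr_sumr lerD2l ler_wpM2l//; exact: aA.
exists ((S 0%N ^+ 2 + c' * A) / (1 - lam)) => N.
rewrite -/(Q N) ler_pdivlMr//.
have : Q N <= Q N.+1 by rewrite /Q big_ord_recr/= lerDl sqr_ge0.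
have := QS N; nra.
Qed.

Lemma bounded_sum_tail (R : realType) (q : nat -> R) (B : R) :
  (forall k, 0 <= q k) -> (forall N : nat, \sum_(k < N) q k <= B) ->
  forall eta, 0 < eta -> exists k0, forall k, (k0 <= k)%N -> forall m,
    \sum_(j < m) q j <= \sum_(j < k) q j + eta.
Proof.
move=> q0 qB eta eta0.
pose E := range (fun N : nat => \sum_(k < N) q k).
have Eub : has_ubound E by exists B => _ [N _ <-].
have hE : has_sup E by split => //; exists (\sum_(k < 0) q k), 0%N.
have [_ [k0 _ <-] Hk0] := sup_adherent eta0 hE.
exists k0 => k k0k m.
have H1 : \sum_(j < m) q j <= sup E by apply: ub_le_sup => //; exists m.
have H2 : \sum_(j < k0) q j <= \sum_(j < k) q j.
  rewrite -(subnK k0k) addnC big_split_ord/= lerDl.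
  by apply: sumr_ge0 => j _; exact: q0.
lra.
Qed.

(** * Disagreement and descent of the mean *)

Section disagreement.
Variables (R : realType) (n d : nat) (L : R -> 'M[R]_n) (Phi : R -> R -> 'M[R]_n).
Hypothesis n0 : (0 < n)%N.
Hypothesis Lb : forall t, 0 <= t -> weight_balanced (L t).
Hypothesis flow : is_flow L Phi.
Variables (C lam : R).
Hypotheses (l0 : 0 < lam) (l1 : lam < 1) (C0 : 0 < C).
Hypothesis HC : forall s t (y : 'M[R]_(n, d)), 0 <= s -> s <= t ->
   avg_mx R n *m y = 0 -> fro (Phi t s *m y) <= C * lam `^ (t - s) * fro y.

(** [S k] is the bound of [tracking_sum] at integer times; it obeys
    [S k.+1 = lam * S k + C * K * a k]. Within a unit interval the disagreement
    can grow by at most [K * a k]. *)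
Lemma disagreement_square_summable (x u : R -> 'M[R]_(n, d)) (a : nat -> R) (K A : R) :
  caratheodory 0 x (fun t => - (L t *m x t) + u t) ->
  0 <= K -> (forall k, 0 <= a k) ->
  (forall N : nat, \sum_(k < N) a k ^+ 2 <= A) ->
  (forall (k : nat) t, k%:R <= t <= k.+1%:R -> fro (centering_mx R n *m u t) <= K * a k) ->
  exists D : nat -> R, [/\ forall k, 0 <= D k,
    forall (k : nat) t, k%:R <= t <= k.+1%:R -> fro (centering_mx R n *m x t) <= D k &
    exists B, forall N : nat, \sum_(k < N) D k ^+ 2 <= B].
Proof.
move=> cx K0 a0 aA uK.
set e := fun t => centering_mx R n *m x t.
have ce : caratheodory 0 e _ := center_solution Lb cx.
have ka0 k : 0 <= K * a k by rewrite mulr_ge0.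
have leS k : k%:R <= k.+1%:R :> R by rewrite ler_nat.
have Ulin k : {ae @lebesgue_measure R, forall t : R, k%:R <= t <= k.+1%:R ->
    is_derive t 1 (fun t => (K * a k) * t) (K * a k)}.
  have FF := ae_filter_ringOfSetsType (@lebesgue_measure R).
  apply: nearW => t _; rewrite -[X in is_derive _ _ _ X]mulr1.
  exact: (@is_deriveZ _ _ _ id).
have defect k : fro (e k.+1%:R - Phi k.+1%:R k%:R *m e k%:R) <= K * a k.
  rewrite -[leRHS]mulr1 -[X in _ * X](_ : k.+1%:R - k%:R = 1); last first.
    by rewrite -natrB// subSnn.
  rewrite mulrBr.
  apply: (@defect_le _ _ _ L Phi Lb flow e _ (fun t => K * a k * t)
    (fun=> K * a k) _ _ _ _ ce) => //; last exact: uK.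
  by move=> q r _ qr _; rewrite ler_wpM2l.
pose S k := C * (lam `^ k%:R * fro (e 0) +
                 \sum_(j < k) lam `^ (k%:R - j.+1%:R) * (K * a j)).
have eS k : fro (e k%:R) <= S k.
  have := tracking_sum (tt := fun k => k%:R) Lb flow l0 (ltW C0) HC ce (avg_center _ n0)
    _ (erefl _) leS defect (m := k) (lexx _).
  rewrite (flow (ler0n _ _)).1 mul1mx; apply.
  by move=> t _; exact: avg_center.
have S0 k : 0 <= S k.
  rewrite mulr_ge0 ?(ltW C0)// addr_ge0 ?mulr_ge0 ?powR_ge0 ?fro_ge0//.
  by apply: sumr_ge0 => j _; rewrite mulr_ge0 ?powR_ge0.
have powS t : lam `^ (t + 1) = lam * lam `^ t.
  rewrite powRD; last by rewrite (gt_eqF l0) implybT.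
  by rewrite powRr1 ?(ltW l0)// mulrC.
have Srec k : S k.+1 <= lam * S k + (C * K) * a k.
  rewrite /S big_ord_recr/= subrr powRr0 mul1r -natr1 powS.
  rewrite (eq_bigr (fun j : 'I_k => lam * (lam `^ (k%:R - j.+1%:R) * (K * a j)))).
    by rewrite -mulr_sumr le_eqVlt; apply/orP; left; apply/eqP; ring.
  by move=> j _; rewrite addrAC powS -mulrA.
have [B HB] := sqr_sum_recursion l0 l1 S0 aA Srec.
exists (fun k => S k + K * a k); split.
- by move=> k; rewrite addr_ge0.
- move=> k t /andP[kt tk].
  have t0 : 0 <= k%:R :> R by [].
  apply: le_trans (dissipative_estimate Lb t0 kt (caratheodory_restrict t0 ce)
    (U := fun t => K * a k * t) (dU := fun=> K * a k) _ _ _) _.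
  + by move=> q r _ qr _; rewrite ler_wpM2l.
  + have FF := ae_filter_ringOfSetsType (@lebesgue_measure R).
    apply: filterS (Ulin k) => r H /andP[kr rt]; apply: H.
    by rewrite kr (le_trans rt).
  + by move=> r /andP[kr rt]; apply: uK; rewrite kr (le_trans rt).
  + apply: lerD; first exact: eS.
    rewrite -mulrBr -[leRHS]mulr1 ler_wpM2l//.
    by rewrite lerBlDl -natr1 in tk *; rewrite addrC in tk *.
- exists (2 * B + 2 * K ^+ 2 * A) => N.
  apply: (@le_trans _ _ (\sum_(k < N) (2 * S k ^+ 2 + 2 * K ^+ 2 * a k ^+ 2))).
    apply: ler_sum => k _; rewrite -subr_ge0.
    have -> : 2 * S k ^+ 2 + 2 * K ^+ 2 * a k ^+ 2 - (S k + K * a k) ^+ 2 =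
      (S k - K * a k) ^+ 2 by ring.
    exact: sqr_ge0.
  rewrite big_split/= -!mulr_sumr; apply: lerD.
    by apply: ler_wpM2l => //; exact: HB.
  by apply: ler_wpM2l; [rewrite mulr_ge0 ?sqr_ge0|exact: aA].
Qed.

End disagreement.

Lemma ip_sumr (R : realType) (m k : nat) (I : finType) (A : 'M[R]_(m, k))
    (B : I -> 'M[R]_(m, k)) : ip A (\sum_i B i) = \sum_i ip A (B i).
Proof.
apply: (big_morph (ip A) (ipDr A)).
by rewrite -[0 in LHS](scale0r (0 : 'M[R]_(m, k))) ipZr mul0r.
Qed.

Section descent.
Variables (R : realType) (n d : nat) (f : 'I_n -> 'rV[R]_d -> R) (M : R).
Hypothesis n0 : (0 < n)%N.
Hypothesis cf : forall i, convex_function (setT : set (convex_lmodType 'rV[R]_d)) (f i).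
Hypothesis df : forall i z, differentiable (f i) z.
Hypothesis M0 : 0 <= M.
Hypothesis gM : forall i z, l2norm (grad (f i) z) <= M.

Let F z := \sum_(i < n) f i z.

(** Splitting m - z as (x_i - z) - (x_i - m), the gradient inequality at x_i
    handles the first part; boundedness of the gradients handles the second and,
    through the gradient inequality at the mean m, the replacement of f_i(x_i)
    by f_i(m). *)
Lemma descent_inequality (X : 'M[R]_(n, d)) (z : 'rV[R]_d) (al : R) : 0 <= al ->
  ip (row_mean X - z) (n%:R^-1 *: \sum_(i < n) (- al *: grad (f i) (row i X))) <=
  - (al / n%:R * (F (row_mean X) - F z)) + 2 * M * (al * fro (centering_mx R n *m X)).
Proof.
move=> al0; set m := row_mean X; set E := fro _.
have H i : f i m - f i z - 2 * M * E <= ip (m - z) (grad (f i) (row i X)).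
  have h1 := convex_grad_le z (cf i) (df i (row i X)).
  have h2 := convex_grad_le (row i X) (cf i) (df i m).
  have rE : fro (row i X - m) <= E by rewrite -row_center; exact: fro_row.
  have ME (y : 'rV_d) : fro (grad (f i) y) * fro (row i X - m) <= M * E.
    by rewrite ler_pM ?fro_ge0// -l2norm_fro.
  have h3 := le_trans (ip_le (grad (f i) (row i X)) (row i X - m)) (ME _).
  have h4 : - (M * E) <= ip (grad (f i) m) (row i X - m).
    by apply: le_trans (ip_ge _ _); rewrite lerN2.
  rewrite ipC (_ : m - z = - (z - row i X) - (row i X - m)); last first.
    by rewrite !opprB [RHS]addrC subrKA.
  rewrite ipDr !ipNr; lra.
have nn : 0 < n%:R :> R by rewrite ltr0n.
rewrite ipZr ip_sumr mulrC ler_pdivrMr//.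
have -> : (- (al / n%:R * (F m - F z)) + 2 * M * (al * E)) * n%:R =
   \sum_(i < n) - al * (f i m - f i z - 2 * M * E).
  rewrite -mulr_sumr !sumrB sumr_const card_ord -[_ *+ n]mulr_natl -/(F m) -/(F z).
  by field; rewrite gt_eqF.
by apply: ler_sum => i _; rewrite ipZr ler_wnM2l// oppr_le0.
Qed.

Variables (x u : R -> 'M[R]_(n, d)) (alpha : R -> R) (D : nat -> R) (Qm : R).
Hypothesis cx : caratheodory 0 (fun t => row_mean (x t))
  (fun t => n%:R^-1 *: \sum_(i < n) row i (u t)).
Hypothesis alpha01 : forall t, 0 <= t -> 0 < alpha t <= 1.
Hypothesis alpha_mono : forall s t, 0 <= s -> s <= t -> alpha t <= alpha s.
Hypothesis fb : forall i t, 0 <= t ->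
  row i (u t) = - alpha t *: grad (f i) (row i (x t)).
Hypothesis D0 : forall k, 0 <= D k.
Hypothesis xD : forall (k : nat) t, k%:R <= t <= k.+1%:R ->
  fro (centering_mx R n *m x t) <= D k.

Let q (k : nat) := 2 * M * (alpha k%:R * D k).
Hypothesis qQ : forall N : nat, \sum_(k < N) q k <= Qm.

Let xb t := row_mean (x t).
Let Rz z t := rfro 1 (xb t - z).

Let Rz1 z t : 1 <= Rz z t. Proof. exact: rfro_ge. Qed.

Let q0 k : 0 <= q k.
Proof.
rewrite /q !mulr_ge0//; first by have /andP[/ltW] := alpha01 (ler0n R k).
Qed.

(** [Rz z] is the smoothed distance of the mean to [z]. As it is at least 1,
    dividing the derivative of half its square by it does not enlarge the error. *)
Lemma radius_step z (k : nat) (s b kappa : R) : k%:R <= s -> s <= b -> b <= k.+1%:R ->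
  (forall t, s <= t <= b ->
     - (alpha t / n%:R * (F (xb t) - F z)) / Rz z t + q k <= kappa) ->
  Rz z b <= Rz z s + kappa * (b - s).
Proof.
move=> ks sb bk H.
have s0 : 0 <= s by apply: le_trans ks.
have [acx dx] := caratheodory_restrict s0 cx.
rewrite -lerBlDl mulrBr.
apply: (@abs_continuous_comparison R (Rz z) (fun t => kappa * t) s b `|kappa|) => //.
- apply: (@abs_continuous_lip _ _ _ _ _ (1 * d)%:R _ _ _ (acx b)) => p r.
  apply: le_trans (rfro_lip _ _ _) _.
  by rewrite opprB addrA subrK; exact: fro_le_norm.
- move=> p r sp pr rb; rewrite -mulrBr -opprB mulrN.
  apply: le_trans (ler_norm _) _; rewrite normrN normrM.
  by rewrite [X in _ * X]ger0_norm// subr_ge0.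
- have FF := ae_filter_ringOfSetsType (@lebesgue_measure R).
  apply: filterS dx => t dxt /[dup] stb /andP[st tb].
  have t0 : 0 <= t by exact: le_trans st.
  have {}dxt := dxt st.
  set v := (X in is_derive _ _ _ X) in dxt.
  have dy : is_derive t 1 (fun t => xb t - z) v.
    by rewrite -[v]subr0; exact: is_deriveB.
  have dR := is_derive_rfro ltr01 dy.
  have dk : is_derive t 1 (fun t => kappa * t) kappa.
    by rewrite -[X in is_derive _ _ _ X]mulr1; exact: (@is_deriveZ _ _ _ id).
  exists (ip (xb t - z) v / Rz z t - kappa); last exact: is_deriveB.
  rewrite subr_le0; apply: le_trans (H t stb).
  have R0 : 0 < Rz z t by apply: lt_le_trans (Rz1 z t).
  have /andP[al0 _] := alpha01 t0.
  have vE : ip (xb t - z) v <= - (alpha t / n%:R * (F (xb t) - F z)) +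
     2 * M * (alpha t * fro (centering_mx R n *m x t)).
    rewrite /v (eq_bigr (fun i => - alpha t *: grad (f i) (row i (x t)))).
      exact/descent_inequality/ltW.
    by move=> i _; exact: fb.
  rewrite ler_pdivrMr// mulrDl divfK ?gt_eqF//; apply: (le_trans vE).
  rewrite lerD2l.
  have k0 : 0 <= k%:R :> R by [].
  have kt := le_trans ks st.
  apply: (@le_trans _ _ (q k)); last by rewrite ler_peMr.
  rewrite /q ler_wpM2l ?mulr_ge0// ler_pM ?fro_ge0 ?(ltW al0)//.
    exact: alpha_mono.
  by apply: xD; rewrite kt (le_trans tb bk).
Qed.

Lemma radius_le z (k : nat) (s b : R) : argmin F z ->
  k%:R <= s -> s <= b -> b <= k.+1%:R -> Rz z b <= Rz z s + q k.
Proof.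
move=> zmin ks sb bk.
have s0 : 0 <= s by apply: le_trans ks.
apply: le_trans (@radius_step z k s b (q k) ks sb bk _) _.
  move=> t /andP[st tb]; rewrite gerDr mulNr oppr_le0.
  have /andP[al0 _] := alpha01 (le_trans s0 st).
  have R0 : 0 <= Rz z t by apply: le_trans (Rz1 z t).
  have Fz : F z <= F (xb t) by exact: zmin.
  by rewrite divr_ge0// mulr_ge0 ?subr_ge0// divr_ge0// ltW.
rewrite lerD2l ler_piMr// lerBlDr.
apply: (le_trans bk); rewrite -natr1 addrC lerD2l //.
Qed.

(** After a time in the [k]-th unit interval, the distance to a minimizer grows
    at most by the terms of the error series from [k] on. *)
Lemma radius_le_tail z (k m : nat) (s b : R) : argmin F z ->
  k%:R <= s -> s <= k.+1%:R -> (k <= m)%N -> s <= b -> m%:R <= b -> b <= m.+1%:R ->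
  Rz z b <= Rz z s + (\sum_(j < m.+1) q j - \sum_(j < k) q j).
Proof.
move=> zmin ks sk; elim: m b => [|m IH] b km sb mb bm.
  have k0 : k = 0%N by apply/eqP; rewrite -leqn0.
  by subst k; rewrite big_ord0 subr0 big_ord1; apply: radius_le.
have [kE|km'] := eqVneq k m.+1.
  move: ks sk; rewrite kE => ks sk.
  by rewrite big_ord_recr/= [X in _ + X]addrC addKr; apply: radius_le.
have {km km'}km : (k <= m)%N by rewrite -ltnS ltn_neqAle km'.
have sm : s <= m.+1%:R by rewrite (le_trans sk)// ler_nat ltnS.
have := IH m.+1%:R km sm; rewrite ler_nat leqnSn lexx => /(_ isT isT).
have := radius_le zmin (lexx _) mb bm; rewrite [in X in _ -> _ -> X]big_ord_recr/=.
lra.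
Qed.

Lemma radius_bounded z t : argmin F z -> 0 <= t -> Rz z t <= Rz z 0 + Qm.
Proof.
move=> zmin t0; have /andP[t1 t2] := truncn_itv t0.
have := @radius_le_tail z 0 (Num.truncn t) 0 t zmin (lexx _) (ler0n _ _) (leq0n _)
  t0 t1 (ltW t2).
move=> /le_trans; apply; by rewrite big_ord0 subr0 lerD2l.
Qed.

Hypothesis alpha_div : forall B : R, exists N : nat, B < \sum_(k < N) alpha k%:R.

(** Otherwise the distance would decrease, up to a summable error, by a fixed
    multiple of [alpha k.+1] on each unit interval, whereas the series of
    [alpha k] diverges. *)
Lemma value_liminf z eps (N : nat) : argmin F z -> 0 < eps ->
  exists2 t, N%:R <= t & F (xb t) < F z + eps.
Proof.
move=> zmin eps0; apply: contrapT => H.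
have {}H t : N%:R <= t -> F z + eps <= F (xb t).
  by move=> Nt; rewrite leNgt; apply/negP => h; apply: H; exists t.
pose B := Rz z 0 + Qm.
have Qm0 : 0 <= Qm by have := qQ 0; rewrite big_ord0.
have B1 : 1 <= B by rewrite /B ler_wpDr// Rz1.
have B0 : 0 < B by exact: lt_le_trans B1.
have nn : 0 < n%:R :> R by rewrite ltr0n.
pose c := eps / (n%:R * B).
have c0 : 0 < c by rewrite divr_gt0// mulr_gt0.
have step k : (N <= k)%N -> Rz z k.+1%:R <= Rz z k%:R + q k - c * alpha k.+1%:R.
  move=> Nk; rewrite -addrA -[q k - _]mulr1.
  rewrite -[X in _ * X](_ : k.+1%:R - k%:R = 1); last first.
    by rewrite -natrB// subSnn.
  apply: radius_step => //; first by rewrite ler_nat.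
  move=> t /andP[kt tk]; rewrite addrC lerD2l mulNr lerN2.
  have t0 : 0 <= t by apply: le_trans kt.
  rewrite ler_pdivlMr ?(lt_le_trans ltr01)//.
  have h1 : alpha k.+1%:R <= alpha t by exact: alpha_mono.
  have h2 : Rz z t <= B by exact: radius_bounded.
  have h3 : eps <= F (xb t) - F z.
    by rewrite lerBrDl H// (le_trans _ kt)// ler_nat.
  have /andP[al0 _] := alpha01 (ler0n R k.+1).
  have R0 : 0 <= Rz z t by apply: le_trans (Rz1 z t).
  apply: (@le_trans _ _ (c * alpha k.+1%:R * B)).
    by rewrite ler_wpM2l// mulr_ge0// ltW.
  have -> : c * alpha k.+1%:R * B = alpha k.+1%:R / n%:R * eps.
    by rewrite /c; field; rewrite !gt_eqF.
  apply: ler_pM => //; [by rewrite divr_ge0 ?ltW|exact: ltW|].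
  by rewrite ler_wpM2r// invr_ge0 ltW.
have long m : Rz z (N + m)%:R <= Rz z N%:R + (\sum_(j < N + m) q j - \sum_(j < N) q j)
    - c * (\sum_(j < (N + m).+1) alpha j%:R - \sum_(j < N.+1) alpha j%:R).
  elim: m => [|m IH]; first by rewrite addn0 !subrr mulr0 subr0 addr0.
  rewrite addnS big_ord_recr/= [\sum_(j < (N + m).+2) _]big_ord_recr/=.
  have := step (N + m)%N (leq_addr _ _); lra.
have [m Hm] := alpha_div ((Rz z N%:R + Qm) / c + \sum_(j < N.+1) alpha j%:R).
have Hm' : (Rz z N%:R + Qm) / c <
    \sum_(j < (N + m).+1) alpha j%:R - \sum_(j < N.+1) alpha j%:R.
  rewrite ltrBrDr; apply: (lt_le_trans Hm).
  rewrite -addSn addnC big_split_ord/= lerDl.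
  by apply: sumr_ge0 => j _; have /andP[/ltW] := alpha01 (ler0n R (rshift m j)).
have := long m; have := Rz1 z (N + m)%:R.
have : 0 <= \sum_(j < N) q j by apply: sumr_ge0 => j _.
have := qQ (N + m).
move: Hm'; rewrite ltr_pdivrMr// mulrC; lra.
Qed.

End descent.

(** * Convergence of the distributed gradient flow *)

(** Closed balls are compact in finite dimension. *)
Lemma bounded_seq_cluster (R : realType) (d : nat) (v : nat -> 'rV[R]_d) (B : R) :
  (forall j, `|v j| <= B) ->
  exists p, forall eta (k : nat), 0 < eta -> exists2 j, (k <= j)%N & `|p - v j| < eta.
Proof.
move=> vB.
have B1 : 0 < `|B| + 1 by rewrite ltr_wpDl.
have cA : compact (closed_ball (0 : 'rV[R]_d) (`|B| + 1)).
  apply: bounded_closed_compact; last exact: closed_ball_closed.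
  exists (`|B| + 1); split; first exact: num_real.
  move=> r Br w; rewrite closed_ballE//= /closed_ball_/= sub0r normrN => wB.
  by rewrite (le_trans wB)// ltW.
have [|p [_ clp]] := cA (v @ \oo).
  exists 0%N => // j _; rewrite /= closed_ballE//= /closed_ball_/= sub0r normrN.
  apply: le_trans (vB j) _; apply: le_trans (ler_norm _) _; by rewrite lerDl.
exists p => eta k eta0.
have [||_ [[j /= kj <-] /= pj]] := clp [set v j | j in [set j | (k <= j)%N]] (ball p eta).
- by exists k => // j /= kj; exists j.
- exact: nbhsx_ballx.
by exists j => //; move: pj; rewrite -ball_normE.
Qed.

Lemma continuous_fsum (R : realType) (n d : nat) (f : 'I_n -> 'rV[R]_d -> R) (p : 'rV[R]_d) :
  (forall i z, differentiable (f i) z) ->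
  forall eps, 0 < eps -> exists2 eta, 0 < eta & forall y, `|p - y| < eta ->
   \sum_(i < n) f i p - \sum_(i < n) f i y < eps.
Proof.
move=> df eps eps0.
have dF : differentiable (\sum_(i < n) f i) p by apply: differentiable_sum.
have /cvgrPdist_lt/(_ _ eps0) := differentiable_continuous dF.
move=> /nbhs_normP[eta /= eta0 H].
exists eta => // y py; have := H y py; rewrite /= !fct_sumE.
by move=> /ltr_normlW.
Qed.

(** [tj j] is a time after [j] at which the mean is within [1 / j.+1] of
    optimal, and [p] is a cluster point of these means. Smallness at one late
    time propagates because the error series converges. *)
Lemma distributed_gradient_cvg (R : realType) (n d : nat) (L : R -> 'M[R]_n)
    (Phi : R -> R -> 'M[R]_n) (f : 'I_n -> 'rV[R]_d -> R) (alpha : R -> R)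
    (x u : R -> 'M[R]_(n, d)) :
  (0 < n)%N ->
  (forall t, 0 <= t -> weight_balanced (L t)) ->
  is_flow L Phi -> weakly_exp_ergodic Phi ->
  (forall i, convex_function (setT : set (convex_lmodType 'rV[R]_d)) (f i)) ->
  (forall i z, differentiable (f i) z) ->
  (forall i, exists M : R, forall z, l2norm (grad (f i) z) <= M) ->
  argmin (fun z => \sum_(i < n) f i z) !=set0 ->
  (forall t, 0 <= t -> 0 < alpha t <= 1) ->
  (forall s t, 0 <= s -> s <= t -> alpha t <= alpha s) ->
  (\int[@lebesgue_measure R]_(t in `[0%R, +oo[) (alpha t)%:E = +oo)%E ->
  (\int[@lebesgue_measure R]_(t in `[0%R, +oo[) (alpha t ^+ 2)%:E < +oo)%E ->
  caratheodory 0 x (fun t => - (L t *m x t) + u t) ->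
  (forall i t, 0 <= t -> row i (u t) = - alpha t *: grad (f i) (row i (x t))) ->
  exists2 xstar : 'rV[R]_d,
    argmin (fun z => \sum_(i < n) f i z) xstar &
    forall i, row i (x t) @[t --> +oo] --> xstar.
Proof.
move=> n0 Lb flow erg cf df gM [z zmin] alpha01 alpha_mono alpha_inf alpha_fin cx fb.
have [C [lam [/andP[l0 l1] C0 HC]]] := @flow_contraction _ _ d _ n0 erg.
have [Mi HMi] := choice gM.
pose M := \sum_i `|Mi i|.
have M0 : 0 <= M by apply: sumr_ge0.
have {}gM i y : l2norm (grad (f i) y) <= M.
  apply: le_trans (HMi i y) _; apply: le_trans (ler_norm _) _.
  by rewrite /M (bigD1 i)//= lerDl sumr_ge0.
have al0 t : 0 <= t -> 0 <= alpha t by move=> /alpha01/andP[/ltW].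
(* Extended by its value at 0, the step size is monotone on the whole line. *)
pose bt t := alpha (Num.max 0 t).
have btE t : 0 <= t -> bt t = alpha t by move=> t0; rewrite /bt max_r.
have bt0 t : 0 <= bt t by apply: al0; rewrite le_max lexx.
have bt_mono s t : s <= t -> bt t <= bt s.
  move=> st; apply: alpha_mono; first by rewrite le_max lexx.
  by rewrite ge_max !le_max lexx st orbT.
have alpha_div B : exists N : nat, B < \sum_(k < N) alpha k%:R.
  have [|N HN] := @sum_unbounded_of_integral _ bt bt0 bt_mono _ B.
    rewrite -alpha_inf; apply: eq_integral => t; rewrite inE/= in_itv/= andbT => t0.
    by rewrite btE.
  by exists N; apply: (lt_le_trans HN); apply: ler_sum => k _; rewrite btE.
have [A HA] : exists A, forall N : nat, \sum_(k < N) alpha k%:R ^+ 2 <= A.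
  have [|||A HA] := @sum_bounded_of_integral _ (fun t => bt t ^+ 2).
  - by move=> t; exact: sqr_ge0.
  - by move=> s t st; rewrite ler_sqr ?nnegrE//; exact: bt_mono.
  - apply: le_lt_trans alpha_fin; rewrite le_eqVlt; apply/orP; left; apply/eqP.
    by apply: eq_integral => t; rewrite inE/= in_itv/= andbT => t0; rewrite btE.
  exists (alpha 0 ^+ 2 + A) => N.
  apply: (@le_trans _ _ (\sum_(k < N.+1) alpha k%:R ^+ 2)).
    by rewrite big_ord_recr/= lerDl sqr_ge0.
  rewrite big_ord_recl/= lerD2l; apply: le_trans (HA N).
  by apply: ler_sum => k _; rewrite btE.
clear alpha_inf alpha_fin.
pose K := fro (centering_mx R n) * (n%:R * M).
have K0 : 0 <= K by rewrite !mulr_ge0 ?fro_ge0.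
have nn : 0 < n%:R :> R by rewrite ltr0n.
have uK (k : nat) t : k%:R <= t <= k.+1%:R ->
    fro (centering_mx R n *m u t) <= K * alpha k%:R.
  move=> /andP[kt _]; have t0 : 0 <= t by apply: le_trans kt.
  apply: le_trans (froM _ _) _; rewrite /K -mulrA ler_wpM2l ?fro_ge0//.
  apply: (@le_trans _ _ (n%:R * M * alpha t)); last first.
    by rewrite ler_wpM2l ?mulr_ge0//; exact: alpha_mono.
  apply: fro_le; first by rewrite !mulr_ge0// al0.
  rewrite -sqr_fro sqr_fro_rows.
  apply: (@le_trans _ _ (\sum_(i < n) (M * alpha t) ^+ 2)).
    apply: ler_sum => i _; rewrite ler_sqr ?nnegrE ?fro_ge0 ?mulr_ge0 ?al0//.
    rewrite fb// froZ normrN ger0_norm ?al0// mulrC ler_wpM2r ?al0//.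
    by rewrite -l2norm_fro.
  rewrite sumr_const card_ord -[leLHS]mulr_natl -mulrA [leRHS]exprMn.
  by rewrite ler_wpM2r ?sqr_ge0// ler_eXnr// ler1n.
have [D [D0 xD [B HB]]] := disagreement_square_summable n0 Lb flow l0 l1 C0 HC cx K0
  (fun k => al0 k%:R (ler0n _ _)) HA uK.
have qQ (N : nat) : \sum_(k < N) 2 * M * (alpha k%:R * D k) <= M * (A + B).
  rewrite -mulr_sumr -mulrAC mulrC ler_wpM2l//.
  rewrite mulr_sumr; apply: le_trans (lerD (HA N) (HB N)); rewrite -big_split/=.
  by apply: ler_sum => k _; have := sqr_ge0 (alpha k%:R - D k); nra.
have cxb := caratheodory_row_mean Lb cx.
have q0 k : 0 <= 2 * M * (alpha k%:R * D k) by rewrite !mulr_ge0 ?al0.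
have liminf (j : nat) : exists t, j%:R <= t /\
    \sum_(i < n) f i (row_mean (x t)) < \sum_(i < n) f i z + j.+1%:R^-1.
  have [|t jt Ht] := value_liminf n0 cf df M0 gM cxb alpha01 alpha_mono fb D0 xD qQ
    alpha_div j zmin (eps := j.+1%:R^-1); first by rewrite invr_gt0.
  by exists t.
have [tj Htj] := choice liminf.
have tj0 j : 0 <= tj j by have [jt _] := Htj j; apply: le_trans jt.
have [p Hp] : exists p, forall eta (k : nat), 0 < eta ->
    exists2 j, (k <= j)%N & `|p - row_mean (x (tj j))| < eta.
  apply: (@bounded_seq_cluster _ _ _ (rfro 1 (row_mean (x 0) - z) + M * (A + B) + fro z)) => j.
  apply: le_trans (norm_le_fro _) _; rewrite -[row_mean _](subrK z).
  apply: le_trans (froD _ _) _; rewrite lerD2r.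
  apply: le_trans (fro_le_rfro 1 _) _.
  exact: (radius_bounded n0 cf df M0 gM cxb alpha01 alpha_mono fb D0 xD qQ zmin (tj0 j)).
have pmin : argmin (fun y => \sum_(i < n) f i y) p.
  move=> y; apply: le_trans (zmin y); rewrite leNgt; apply/negP => zp.
  set e := (\sum_(i < n) f i p - \sum_(i < n) f i z) / 2.
  have e0 : 0 < e by rewrite divr_gt0// subr_gt0.
  have [eta eta0 Heta] := continuous_fsum p df e0.
  have [j jN pj] := Hp _ (Num.bound e^-1) eta0.
  have h1 := Heta _ pj; have [_ h2] := Htj j.
  have : j.+1%:R^-1 < e.
    rewrite invf_plt ?posrE//; apply: lt_le_trans (archi_boundP _) _; first by rewrite invr_ge0 ltW.
    by rewrite ler_nat (leq_trans jN).
  have half_gap (a b c r : R) :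
      a - b < (a - c) / 2 -> b < c + r -> r < (a - c) / 2 -> False.
    by move=> *; lra.
  exact: half_gap h1 h2.
exists p => // i; apply/cvgrPdist_lt => e e0.
(* Chosen so that (1 + 2 eta)^2 - 1 <= 8 eta <= (e / 2)^2. *)
pose eta := Num.min 1 (e ^+ 2 / 32).
have eta0 : 0 < eta by rewrite lt_min ltr01 divr_gt0// exprn_gt0.
have [k0 Hk0] := bounded_sum_tail q0 qQ eta0.
have [|k1 Hk1] := bounded_sum_tail (fun k => sqr_ge0 (D k)) HB (eta := (e / 4) ^+ 2).
  by rewrite exprn_gt0// divr_gt0.
have [|j k0j pj] := Hp (eta / (d%:R + 1)) k0.
  by rewrite divr_gt0// ltr_wpDl.
have Rj : rfro 1 (row_mean (x (tj j)) - p) <= 1 + eta.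
  apply: le_trans (rfro_le _ ler01) _; rewrite addrC lerD2l.
  apply: le_trans (fro_le_norm _) _; rewrite mul1n distrC.
  apply: (@le_trans _ _ ((d%:R + 1) * `|p - row_mean (x (tj j))|)).
    by rewrite ler_wpM2r// lerDl.
  by rewrite -ler_pdivlMl ?ltr_wpDl// mulrC ltW.
have [jt _] := Htj j.
exists (Num.max (tj j) k1%:R); split; first exact: num_real.
move=> t; rewrite gt_max => /andP[/ltW tjt /ltW k1t].
have t0 : 0 <= t by apply: le_trans tjt.
have /andP[ht1 ht2] := truncn_itv t0; set m := Num.truncn t in ht1 ht2.
have /andP[hk1 hk2] := truncn_itv (tj0 j); set k := Num.truncn (tj j) in hk1 hk2.
have km : (k <= m)%N by rewrite -ltnS -(ltr_nat R) (le_lt_trans hk1)// (le_lt_trans tjt).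
have k0k : (k0 <= k)%N.
  by apply: (leq_trans k0j); rewrite -ltnS -(ltr_nat R) (le_lt_trans jt).
have k1m : (k1 <= m)%N by rewrite -ltnS -(ltr_nat R) (le_lt_trans k1t).
have Rt : rfro 1 (row_mean (x t) - p) <= 1 + 2 * eta.
  have := radius_le_tail n0 cf df M0 gM cxb alpha01 alpha_mono fb D0 xD pmin hk1 (ltW hk2) km tjt ht1 (ltW ht2).
  have := Hk0 _ k0k m.+1; lra.
have ft : fro (row_mean (x t) - p) <= e / 2.
  apply: fro_le; first by rewrite divr_ge0// ltW.
  have : rfro 1 (row_mean (x t) - p) ^+ 2 <= (1 + 2 * eta) ^+ 2.
    by rewrite ler_sqr ?nnegrE ?sqrtr_ge0 ?addr_ge0 ?mulr_ge0// ltW.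
  rewrite sqr_rfro.
  have : eta <= 1 by rewrite ge_min lexx.
  have : eta <= e ^+ 2 / 32 by rewrite ge_min lexx orbT.
  nra.
have Dm : D m <= e / 4.
  rewrite -ler_sqr ?nnegrE ?divr_ge0 ?(ltW e0)//.
  by have := Hk1 _ k1m m.+1; rewrite big_ord_recr/= lerD2l.
have fe : fro (row i (x t) - row_mean (x t)) <= e / 4.
  rewrite -row_center; apply: le_trans (fro_row _ _) _.
  by apply: le_trans (xD m t _) Dm; rewrite ht1 ltW.
rewrite distrC; apply: le_lt_trans (norm_le_fro _) _.
rewrite -(subrKA (row_mean (x t))); apply: le_lt_trans (froD _ _) _.
lra.
Qed.

Theorem theorem5p1 (R : realType) (n d : nat) (n_ge1 : (1 <= n)%N)
    (d_ge1 : (1 <= d)%N) (L : R -> 'M[R]_n) (Phi : R -> R -> 'M[R]_n)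
    (L_measurable : measurable_family L)
    (L_bounded : locally_ess_bounded L)
    (L_balanced : forall t, 0 <= t -> weight_balanced (L t))
    (Phi_flow : is_flow L Phi)
    (Phi_ergodic : weakly_exp_ergodic Phi) :
  distributed_flow_tracker (D := laplacian_dynamics d L)
    (laplacian_graph L) setT /\
  forall (f : 'I_n -> 'rV[R]_d -> R) (alpha : R -> R)
    (x u : R -> 'M[R]_(n, d)),
    (forall i, convex_function
       (setT : set (convex_lmodType 'rV[R]_d)) (f i)) ->
    (forall i z, differentiable (f i) z) ->
    (forall i, exists M : R, forall z, l2norm (grad (f i) z) <= M) ->
    argmin (fun z => \sum_(i < n) f i z) !=set0 ->
    (forall t, 0 <= t -> 0 < alpha t <= 1) ->
    (forall s t, 0 <= s -> s <= t -> alpha t <= alpha s) ->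
    (\int[@lebesgue_measure R]_(t in `[0%R, +oo[) (alpha t)%:E = +oo)%E ->
    (\int[@lebesgue_measure R]_(t in `[0%R, +oo[) (alpha t ^+ 2)%:E < +oo)%E ->
    caratheodory 0 x (fun t => - (L t *m x t) + u t) ->
    (forall i t, 0 <= t ->
       row i (u t) = - alpha t *: grad (f i) (row i (x t))) ->
    exists2 xstar : 'rV[R]_d,
      argmin (fun z => \sum_(i < n) f i z) xstar &
      forall i, row i (x t) @[t --> +oo] --> xstar.
Proof.
split; first exact: (laplacian_tracker d n_ge1 L_balanced Phi_flow Phi_ergodic).
move=> f alpha x u.
exact: (distributed_gradient_cvg n_ge1 L_balanced Phi_flow Phi_ergodic).
Qed.
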